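(* Consider the problem $\min_{x\in\mathbb{R}^d} f(x)$ with $f(x)=\frac1n\sum_{i=1}^n f_i(x)$, let $x^\star$ be a minimizer of $f$ and $f^\star=f(x^\star)$. Assume $f$ is $\mu$-strongly quasi-convex around $x^\star$ (with $\mu>0$), and each $f_i$ is $L$-smooth and convex. Let the stochastic gradient oracles and the contractive compressor $\mathcal{C}_\delta$ be as described in the context. Then there exists a stepsize $\gamma\le \frac{\delta}{8\sqrt6 L}$ such that after at most $$T=\widetilde{\mathcal O}\left(\frac{\sigma^2}{\mu n\epsilon}+\frac{\sqrt L\,\sigma}{\mu\sqrt\delta\,\epsilon^{1/2}}+\frac{L}{\mu\delta}\right)$$ iterations of Algorithm EC-Ideal (described in the context) it holds $\mathbb{E}[f(x_{\mathrm{out}})-f^\star]\le\epsilon$, where $x_{\mathrm{out}}$ is chosen randomly from $\{x_0,\dots,x_T\}$, with $x_t$ chosen with probability proportional to $(1-\mu\gamma/2)^{-(t+1)}$.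
   Context: Setting: $n$ clients; $f_i:\mathbb{R}^d\to\mathbb{R}$ differentiable. A function $f$ is $\mu$-strongly quasi-convex around $x^\star$ if $f(x^\star)\ge f(y)+\langle\nabla f(y),x^\star-y\rangle+\frac\mu2\|x^\star-y\|^2$ for all $y\in\mathbb{R}^d$. $L$-smooth means $\|\nabla f_i(x)-\nabla f_i(y)\|\le L\|x-y\|$ for all $x,y$. Each client $i$ has a stochastic gradient oracle $g^i(x)$ with $\mathbb{E}[g^i(x)]=\nabla f_i(x)$ and $\mathbb{E}\|g^i(x)-\nabla f_i(x)\|^2\le\sigma^2$ for all $x$, each call using fresh independent randomness. A contractive compressor with parameter $0<\delta\le1$ is a (possibly randomized, with independent randomness at each call) map $\mathcal{C}_\delta:\mathbb{R}^d\to\mathbb{R}^d$ with $\mathbb{E}\|\mathcal{C}_\delta(x)-x\|^2\le(1-\delta)\|x\|^2$ for all $x$. Algorithm EC-Ideal: input $x_0$, stepsize $\gamma>0$, $e_0^i=0$, $h_\star^i:=\nabla f_i(x^\star)$, $h_\star=\frac1n\sum_i h_\star^i$. For $t=0,1,2,\dots$: each client $i$ computes $g_t^i=g^i(x_t)$, $\Delta_t^i=\mathcal{C}_\delta(e_t^i+g_t^i-h_\star^i)$, $e_{t+1}^i=e_t^i+g_t^i-h_\star^i-\Delta_t^i$ and sends $\Delta_t^i$; the server sets $x_{t+1}=x_t-\gamma h_\star-\frac\gamma n\sum_{i=1}^n\Delta_t^i$. Notation: $T=\widetilde{\mathcal O}(A)$ means $T$ is at most an absolute constant times $A$ times factors polylogarithmic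 in the problem parameters and $1/\epsilon$. *)

(* Defs.v *)
From HB Require Import structures.
From mathcomp Require Import all_boot all_order all_algebra.
From mathcomp Require Import all_classical all_reals all_analysis.
Set Implicit Arguments. Unset Strict Implicit. Unset Printing Implicit Defensive.
Import Order.TTheory GRing.Theory Num.Theory.
Import numFieldNormedType.Exports.
Local Open Scope classical_set_scope.
Local Open Scope ring_scope.

Definition dotv {R : realType} {d : nat} (u v : 'rV[R]_d) : R :=
  \sum_(j < d) u 0 j * v 0 j.

Definition enorm {R : realType} {d : nat} (v : 'rV[R]_d) : R :=
  Num.sqrt (dotv v v).

Definition grad {R : realType} {d : nat} (f : 'rV[R]_d -> R) (x : 'rV[R]_d)
  : 'rV[R]_d := \row_j ('d f x (delta_mx 0 j)).

Definition differentiable_everywhere {R : realType} {d : nat}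
  (f : 'rV[R]_d -> R) : Prop := forall x, differentiable f x.

Definition convex_fun {R : realType} {d : nat} (f : 'rV[R]_d -> R) : Prop :=
  forall (x y : 'rV[R]_d) (t : R), 0 <= t <= 1 ->
    f (t *: x + (1 - t) *: y) <= t * f x + (1 - t) * f y.

Definition smooth_fun {R : realType} {d : nat} (L : R) (f : 'rV[R]_d -> R)
  : Prop :=
  forall x y, enorm (grad f x - grad f y) <= L * enorm (x - y).

Definition strongly_quasi_convex {R : realType} {d : nat} (mu : R)
  (f : 'rV[R]_d -> R) (xs : 'rV[R]_d) : Prop :=
  forall y, f y + dotv (grad f y) (xs - y) + mu / 2 * enorm (xs - y) ^+ 2
            <= f xs.

Definition avg_fun {R : realType} {d n : nat} (fs : 'I_n -> 'rV[R]_d -> R)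
  : 'rV[R]_d -> R := fun x => n%:R^-1 * \sum_(i < n) fs i x.

Definition vec_measurable {R : realType} {d : nat} {dT : measure_display}
  {T : measurableType dT} (X : T -> 'rV[R]_d) : Prop :=
  forall j : 'I_d, measurable_fun setT (fun w => X w 0 j).

(* joint measurability of a randomized map  H : R^d x Xi -> R^d
   (stated as: it maps measurable inputs (X, Y) on any measurable space to a
   measurable output); implied by Borel(R^d) (x) F_Xi -measurability *)
Definition jointly_measurable {R : realType} {d : nat} {dX : measure_display}
  {Xi : measurableType dX} (H : 'rV[R]_d -> Xi -> 'rV[R]_d) : Prop :=
  forall (dT : measure_display) (T : measurableType dT)
         (X : T -> 'rV[R]_d) (Y : T -> Xi),
    vec_measurable X -> measurable_fun setT Y ->
    vec_measurable (fun w => H (X w) (Y w)).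

(* Index of an elementary random draw: (iteration t, client i, b) where
   b = false is the draw used by the stochastic-gradient oracle call and
   b = true the draw used by the compressor call. *)
Definition draw_index (n : nat) : Type := (nat * 'I_n * bool)%type.

Definition iid_draws {R : realType} {n : nat} {dO dX : measure_display}
  {Omega : measurableType dO} {Xi : measurableType dX}
  (P : probability Omega R) (PXi : probability Xi R)
  (xi : draw_index n -> Omega -> Xi) : Prop :=
  (forall j, measurable_fun setT (xi j)) /\
  forall (s : seq (draw_index n)) (A : draw_index n -> set Xi),
    uniq s -> (forall j, measurable (A j)) ->
    P (\big[setI/setT]_(j <- s) (xi j @^-1` A j)) =
    (\prod_(j <- s) PXi (A j))%E.

(* state (x_t, (e_t^i)_i) after t iterations, along the sample point w.
   g_t^i = G i x_t (xi (t,i,false) w)   (stochastic gradient oracle of client i)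
   C_delta(v) = C v (xi (t,i,true) w)    (contractive compressor)            *)
Fixpoint ec_ideal {R : realType} {d n : nat} {dO dX : measure_display}
  {Omega : measurableType dO} {Xi : measurableType dX}
  (G : 'I_n -> 'rV[R]_d -> Xi -> 'rV[R]_d) (C : 'rV[R]_d -> Xi -> 'rV[R]_d)
  (xi : draw_index n -> Omega -> Xi) (hs : 'I_n -> 'rV[R]_d)
  (gamma : R) (x0 : 'rV[R]_d) (t : nat) (w : Omega)
  : 'rV[R]_d * ('I_n -> 'rV[R]_d) :=
  match t with
  | 0 => (x0, fun _ => 0)
  | t'.+1 =>
      let st := ec_ideal G C xi hs gamma x0 t' w in
      let x := st.1 in
      let e := st.2 in
      let g := fun i => G i x (xi (t', i, false) w) in
      let Delta := fun i => C (e i + g i - hs i) (xi (t', i, true) w) in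
      let hbar := n%:R^-1 *: \sum_(i < n) hs i in
      (x - gamma *: hbar - (gamma / n%:R) *: \sum_(i < n) Delta i,
       fun i => e i + g i - hs i - Delta i)
  end.

Definition log_params {R : realType} (L mu delta sigma eps r0 : R) (n : nat)
  : R :=
  ln (2 + L + L^-1 + mu + mu^-1 + delta^-1 + sigma + sigma^-1 + n%:R
        + eps + eps^-1 + r0 + r0^-1).

(* Main.v *)
Require Import Defs.
From HB Require Import structures.
From mathcomp Require Import all_boot all_order all_algebra.
From mathcomp Require Import all_classical all_reals all_analysis.
From mathcomp Require Import measurable_realfun ring lra.
Import Order.TTheory GRing.Theory Num.Theory.
Import numFieldNormedType.Exports.
Local Open Scope classical_set_scope.
Local Open Scope ring_scope.

(** Let [xs] be the minimizer and [h_i] the gradient of [f_i] at [xs].  The virtual iterate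
    [x_t - (gamma/n) sum_i e_t^i] performs an exact stochastic gradient step, so
    its squared distance [X_t] to [xs], the mean squared error [E_t] of the
    clients and the optimality gap [F_t] satisfy, in expectation,
    [X_(t+1) + gamma F_t <= (1 - mu gamma/2) X_t + 10 L gamma^3 E_t
    + gamma^2 sigma^2/n] and
    [E_(t+1) <= (1 - delta/2) E_t + (8L/delta) F_t + sigma^2]; the second bound
    has no heterogeneity term because convexity and smoothness give
    [(1/n) sum_i |grad f_i x - h_i|^2 <= 4L (f x - f xs)].  The Lyapunov function
    [X_t + (40 L gamma^3/delta) E_t] then contracts up to noise, and summing with
    weights [(1 - mu gamma/2)^-(t+1)] gives the rate for
    [1/gamma = 32L/delta + 6 sigma^2/(n eps)
    + 16 sqrt L sigma / (sqrt delta sqrt eps)].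

    Conditional expectations are avoided: a fresh draw is independent of the
    sigma-algebra generated by the previous ones, so Tonelli's theorem integrates
    it out with the past frozen. *)

(** * Euclidean vectors and gradients *)

Section Vectors.
Context {R : realType} {d : nat}.
Implicit Types (u v w : 'rV[R]_d) (a : R).

Lemma dotvC u v : dotv u v = dotv v u.
Proof. by apply: eq_bigr => j _; rewrite mulrC. Qed.

Lemma dotvDl u v w : dotv (u + v) w = dotv u w + dotv v w.
Proof.
by rewrite /dotv -big_split; apply: eq_bigr => j _; rewrite mxE mulrDl.
Qed.

Lemma dotvZl a u v : dotv (a *: u) v = a * dotv u v.
Proof.
by rewrite /dotv mulr_sumr; apply: eq_bigr => j _; rewrite mxE mulrA.
Qed.

Lemma dotvNl u v : dotv (- u) v = - dotv u v.
Proof. by rewrite -scaleN1r dotvZl mulN1r. Qed.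

Lemma dotvDr u v w : dotv u (v + w) = dotv u v + dotv u w.
Proof. by rewrite dotvC dotvDl !(dotvC u). Qed.

Lemma dotvZr a u v : dotv u (a *: v) = a * dotv u v.
Proof. by rewrite dotvC dotvZl dotvC. Qed.

Lemma dotvNr u v : dotv u (- v) = - dotv u v.
Proof. by rewrite dotvC dotvNl dotvC. Qed.

Lemma dot0v v : dotv 0 v = 0.
Proof. by rewrite /dotv big1// => j _; rewrite mxE mul0r. Qed.

Lemma dotv_suml (I : Type) (r : seq I) (F : I -> 'rV[R]_d) v :
  dotv (\sum_(i <- r) F i) v = \sum_(i <- r) dotv (F i) v.
Proof.
elim: r => [|i r IH]; first by rewrite !big_nil dot0v.
by rewrite !big_cons dotvDl IH.
Qed.

Lemma dotvv_ge0 v : 0 <= dotv v v.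
Proof. by apply: sumr_ge0 => j _; rewrite -expr2 sqr_ge0. Qed.

Lemma dotvv_eq0 v : dotv v v = 0 -> v = 0.
Proof.
move=> /eqP; rewrite psumr_eq0 => [/allP v0|j _]; last by rewrite -expr2 sqr_ge0.
apply/rowP => j; rewrite mxE.
by move: (v0 j (mem_index_enum j)) => /=; rewrite mulf_eq0 orbb => /eqP.
Qed.

Lemma sqr_enorm v : enorm v ^+ 2 = dotv v v.
Proof. by rewrite /enorm sqr_sqrtr// dotvv_ge0. Qed.

Definition dotvE := (dotvDl, dotvDr, dotvNl, dotvNr, dotvZl, dotvZr).

(** Expand the square of [a *: u - v] and divide by [a]. The weight [a] stays free so that each use
    can balance the two squares. *)
Lemma young_dotv a u v : 0 < a ->
  2 * dotv u v <= a * dotv u u + a^-1 * dotv v v.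
Proof.
move=> a0; have := dotvv_ge0 (a *: u - v); rewrite !dotvE (dotvC v u) => h.
have ai0 : 0 < a^-1 by rewrite invr_gt0.
rewrite -(ler_pM2l a0) -subr_ge0; apply: le_trans h _.
by rewrite le_eqVlt; apply/orP; left; apply/eqP; field; rewrite gt_eqF.
Qed.

(** Jensen for the squared norm: the squared deviations from the mean [m] are nonnegative and add up
    to the sum of squares minus [n] times the square of [m]. *)
Lemma dotvv_avg_le (n : nat) (v : 'I_n -> 'rV[R]_d) : (0 < n)%N ->
  dotv (n%:R^-1 *: \sum_i v i) (n%:R^-1 *: \sum_i v i)
    <= n%:R^-1 * \sum_i dotv (v i) (v i).
Proof.
move=> n0; set m := _ *: _.
have nR0 : 0 < n%:R :> R by rewrite ltr0n.
have nm : \sum_i v i = n%:R *: m by rewrite /m scalerA divff ?gt_eqF// scale1r.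
clearbody m.
have : 0 <= \sum_i dotv (v i - m) (v i - m).
  by apply: sumr_ge0 => i _; exact: dotvv_ge0.
have -> : \sum_i dotv (v i - m) (v i - m) =
    \sum_i dotv (v i) (v i) - n%:R * dotv m m.
  under eq_bigr => i _ do rewrite !dotvE (dotvC m (v i)).
  rewrite !big_split/= sumrN -dotv_suml nm dotvZl sumr_const card_ord -mulr_natl.
  by ring.
by rewrite subr_ge0 => h; rewrite ler_pdivlMl.
Qed.

(** With the next bound, this links the Euclidean norm of the smoothness hypothesis to coordinates,
    because the topology on row vectors comes from the max norm. *)
Lemma enorm_coordB_le u v j : `|u 0 j - v 0 j| <= enorm (u - v).
Proof.
have -> : u 0 j - v 0 j = (u - v) 0 j by rewrite !mxE.
rewrite /enorm -sqrtr_sqr ler_wsqrtr// /dotv (bigD1 j)//= -expr2 lerDl.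
by apply: sumr_ge0 => i _; rewrite -expr2 sqr_ge0.
Qed.

Lemma enorm_le_sum v : enorm v <= \sum_j `|v 0 j|.
Proof.
have s0 : 0 <= \sum_j `|v 0 j| by apply: sumr_ge0.
rewrite -(ler_pXn2r (_ : (0 < 2)%N))// ?nnegrE ?sqrtr_ge0//.
rewrite sqr_enorm expr2 mulr_suml; apply: ler_sum => j _.
rewrite -expr2 -real_normK ?num_real// expr2 ler_wpM2l//.
by rewrite (bigD1 j)//= lerDl; apply: sumr_ge0.
Qed.

End Vectors.

Section Gradients.
Context {R : realType} {d : nat}.
Implicit Types (f : 'rV[R]_d -> R) (x y v : 'rV[R]_d).

Lemma diff_dotv f x v : differentiable f x -> 'd f x v = dotv (grad f x) v.
Proof.
move=> df; rewrite [v in LHS]row_sum_delta linear_sum.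
by apply: eq_bigr => j _; rewrite linearZ /= mxE mulrC.
Qed.

(** The derivative along [v] is the limit of the slopes as [t] decreases to 0, so a bound known only
    for positive [t] passes to the limit. *)
Lemma diff_le_slope f x v c : differentiable f x ->
  (forall t, 0 < t <= 1 -> f (x + t *: v) <= f x + t * c) ->
  dotv (grad f x) v <= c.
Proof.
move=> df h; rewrite -diff_dotv// -deriveE//.
have dv : derivable f x v by exact: diff_derivable.
rewrite /derive cvg_at_rightE; last exact: dv.
apply: limr_le.
  (* Right neighbourhoods of 0 avoid 0, so the punctured limit defining the derivative restricts to
     them. *)
  apply: (cvgP ('D_v f x)); apply: cvg_trans dv; apply: cvg_app.
  by move=> A [e e0 Ae]; exists e => // t te t0; apply: Ae => //; exact: lt0r_neq0.
near=> t.
have t0 : 0 < t by near: t; exact: nbhs_right_gt.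
have t1 : t <= 1 by near: t; apply: nbhs_right_le.
rewrite [_ *: _]/(_ * _) ler_pdivrMl// lerBlDl /= [t *: v + x]addrC.
by apply: h; rewrite t0.
Unshelve. all: by end_near. Qed.

Lemma slope_le_diff f x v c : differentiable f x ->
  (forall t, 0 < t <= 1 -> f x + t * c <= f (x + t *: v)) ->
  c <= dotv (grad f x) v.
Proof.
move=> df h; rewrite -diff_dotv// -deriveE//.
have dv : derivable f x v by exact: diff_derivable.
rewrite /derive cvg_at_rightE; last exact: dv.
apply: limr_ge.
  apply: (cvgP ('D_v f x)); apply: cvg_trans dv; apply: cvg_app.
  by move=> A [e e0 Ae]; exists e => // t te t0; apply: Ae => //; exact: lt0r_neq0.
near=> t.
have t0 : 0 < t by near: t; exact: nbhs_right_gt.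
have t1 : t <= 1 by near: t; apply: nbhs_right_le.
rewrite [_ *: _]/(_ * _) ler_pdivlMl// lerBrDl /= [t *: v + x]addrC.
by apply: h; rewrite t0.
Unshelve. all: by end_near. Qed.

Lemma convex_grad_le f x y : differentiable f x -> convex_fun f ->
  f x + dotv (grad f x) (y - x) <= f y.
Proof.
move=> df cf; rewrite -lerBrDl; apply: diff_le_slope => // t /andP[t0 t1].
have -> : x + t *: (y - x) = t *: y + (1 - t) *: x.
  by rewrite scalerBr scalerBl scale1r addrCA.
apply: le_trans (cf y x t _) _; first by rewrite (ltW t0).
by rewrite le_eqVlt; apply/orP; left; apply/eqP; ring.
Qed.

Lemma smooth_dotvv f (L : R) x y : smooth_fun L f ->
  dotv (grad f x - grad f y) (grad f x - grad f y)
    <= L ^+ 2 * dotv (x - y) (x - y).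
Proof.
move=> sf; rewrite -!sqr_enorm -exprMn.
have le0 : 0 <= L * enorm (x - y) by apply: le_trans (sf x y); rewrite sqrtr_ge0.
by rewrite ler_pXn2r// ?nnegrE ?sqrtr_ge0//; exact: sf.
Qed.

(** Convexity is used twice through the point [z] reached from [x] by a step [g / (2L)]: once from
    [y] to [z], once from [z] to [x]. Adding the two leaves [a] times the inner product of [b + g]
    with [g], and smoothness gives [|b| <= |g| / 2], so at least half of [|g|^2] survives. No
    integration along a segment is involved. *)
Lemma smooth_convex_bregman f (L : R) x y : 0 < L -> differentiable_everywhere f ->
  convex_fun f -> smooth_fun L f ->
  dotv (grad f x - grad f y) (grad f x - grad f y)
    <= 4 * L * (f x - f y - dotv (grad f y) (x - y)).
Proof.
move=> L0 df cf sf; set g := grad f x - grad f y.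
pose a : R := (2 * L)^-1.
have a0 : 0 < a by rewrite invr_gt0 mulr_gt0.
pose z := x - a *: g.
have hy := convex_grad_le f y z (df y) cf.
have hz := convex_grad_le f z x (df z) cf.
have := smooth_dotvv f L z x sf; set b := grad f z - grad f x => hb.
have yb := young_dotv 2 (- b) g (ltr0Sn _ _).
have zb : grad f z = b + g + grad f y by rewrite /b /g addrA subrK subrK.
have xz : x - z = a *: g by rewrite /z opprB addrC subrK.
have zy : z - y = (x - y) - a *: g by rewrite /z addrAC.
have zx : z - x = - (a *: g) by rewrite -opprB xz.
clearbody b g z.
rewrite xz zb !dotvE in hz.
rewrite zy !dotvE in hy.
rewrite zx !dotvE in hb.
rewrite !dotvE in yb.
have aL : a * L = 2^-1 by rewrite /a; field; rewrite gt_eqF.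
have hb' : dotv b b <= 4^-1 * dotv g g.
  apply: le_trans hb _.
  suff -> : L ^+ 2 * - (a * - (a * dotv g g)) = (a * L) ^+ 2 * dotv g g.
    by rewrite aL; lra.
  by ring.
have key : a * (dotv g g / 2) <= f x - f y - dotv (grad f y) (x - y).
  rewrite !dotvE.
  have : a * (dotv g g / 2) <= a * (dotv b g + dotv g g).
    by rewrite ler_pM2l//; lra.
  lra.
suff -> : dotv g g = 4 * L * (a * (dotv g g / 2)).
  by rewrite ler_pM2l ?mulr_gt0.
have -> : 4 * L * (a * (dotv g g / 2)) = 2 * (a * L) * dotv g g by field.
by rewrite aL; field.
Qed.

End Gradients.

(** * The averaged objective and its minimizer *)

Section Objective.
Context {R : realType} {d n : nat}.
Variables (fs : 'I_n -> 'rV[R]_d -> R) (L : R) (xs : 'rV[R]_d).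
Hypotheses (n_gt0 : (0 < n)%N) (L_gt0 : 0 < L).
Hypothesis fs_diff : forall i, differentiable_everywhere (fs i).
Hypothesis fs_convex : forall i, convex_fun (fs i).
Hypothesis fs_smooth : forall i, smooth_fun L (fs i).
Hypothesis xs_min : forall x, avg_fun fs xs <= avg_fun fs x.

Let f := avg_fun fs.

Lemma avg_fun_differentiable x : differentiable f x.
Proof.
rewrite /f (_ : avg_fun fs = n%:R^-1 *: (\sum_(i < n) fs i)).
  by apply: differentiableZ; apply: differentiable_sum => i; exact: fs_diff.
by apply/funext => y; rewrite /avg_fun /= fctE fct_sumE.
Qed.

Lemma grad_avg_fun x : grad f x = n%:R^-1 *: \sum_i grad (fs i) x.
Proof.
apply/rowP => j; rewrite !mxE summxE.
rewrite -deriveE; last exact: avg_fun_differentiable.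
rewrite /f (_ : avg_fun fs = n%:R^-1 *: (\sum_(i < n) fs i)); last first.
  by apply/funext => y; rewrite /avg_fun /= fctE fct_sumE.
have df i : derivable (fs i) x (delta_mx 0 j) by apply: diff_derivable; exact: fs_diff.
rewrite deriveZ; last exact: derivable_sum.
rewrite derive_sum//; congr (_ * _); apply: eq_bigr => i _.
by rewrite mxE deriveE//; exact: fs_diff.
Qed.

(** The slope in the direction of the negative gradient is nonnegative at a minimizer, while it
    equals minus the squared gradient norm. *)
Lemma grad_avg_fun_min : grad f xs = 0.
Proof.
apply: dotvv_eq0; apply/eqP; rewrite eq_le dotvv_ge0 andbT.
have : 0 <= dotv (grad f xs) (- grad f xs).
  apply: slope_le_diff => [|t _]; first exact: avg_fun_differentiable.
  by rewrite mulr0 addr0; exact: xs_min.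
by rewrite dotvNr oppr_ge0.
Qed.

(** Average the Bregman bounds of the clients: the linear terms add up to the gradient of [f] at
    [xs], which vanishes. Centering each client at its own optimal gradient is what removes
    heterogeneity. *)
Lemma grad_dissimilarity_le x :
  n%:R^-1 * \sum_i dotv (grad (fs i) x - grad (fs i) xs)
                        (grad (fs i) x - grad (fs i) xs)
    <= 4 * L * (f x - f xs).
Proof.
have ni0 : 0 <= n%:R^-1 :> R by rewrite invr_ge0.
have -> : 4 * L * (f x - f xs) = n%:R^-1 * \sum_i (4 * L *
    (fs i x - fs i xs - dotv (grad (fs i) xs) (x - xs))).
  rewrite -mulr_sumr mulrCA; congr (_ * _).
  rewrite !big_split/= !sumrN -dotv_suml !mulrDr !mulrN.
  by rewrite -dotvZl -grad_avg_fun grad_avg_fun_min dot0v subr0.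
by rewrite ler_wpM2l// ler_sum// => i _; exact: smooth_convex_bregman.
Qed.

Lemma grad_avg_fun_le x : dotv (grad f x) (grad f x) <= 4 * L * (f x - f xs).
Proof.
have -> : grad f x = n%:R^-1 *: \sum_i (grad (fs i) x - grad (fs i) xs).
  have -> : grad f x = grad f x - grad f xs by rewrite grad_avg_fun_min subr0.
  by rewrite (grad_avg_fun x) (grad_avg_fun xs) -scalerBr -sumrB.
exact: le_trans (dotvv_avg_le _ _ n_gt0) (grad_dissimilarity_le x).
Qed.

(** Tested at one point [x] other than [xs], quasi-convexity bounds the inner product of [grad f x]
    with [x - xs] below by [mu / 2] times [|x - xs|^2], and smoothness bounds it above by [L] times
    the same square. In dimension 0 there is no such point. *)
Lemma strong_quasi_convexity_le_smoothness mu : (0 < d)%N -> 0 < mu ->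
  strongly_quasi_convex mu f xs -> mu <= 2 * L.
Proof.
move=> d0 mu0 /(_ (xs + const_mx 1)); set x := xs + _ => qc.
have xB : x - xs = const_mx 1 by rewrite /x addrC addKr.
have D0 : 0 < dotv (x - xs) (x - xs).
  rewrite lt_neqAle dotvv_ge0 andbT eq_sym; apply/eqP => /dotvv_eq0.
  rewrite xB => /rowP /(_ (Ordinal d0)); rewrite !mxE => /eqP.
  by rewrite oner_eq0.
have Fx := xs_min x; rewrite -/f in Fx.
rewrite sqr_enorm -(opprB x) !dotvNr dotvNl opprK in qc.
have grad_le : dotv (grad f x) (x - xs) <= L * dotv (x - xs) (x - xs).
  have -> : grad f x = n%:R^-1 *: \sum_i (grad (fs i) x - grad (fs i) xs).
    have -> : grad f x = grad f x - grad f xs by rewrite grad_avg_fun_min subr0.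
    by rewrite (grad_avg_fun x) (grad_avg_fun xs) -scalerBr -sumrB.
  rewrite dotvZl dotv_suml ler_pdivrMl ?ltr0n// mulr_natl -[X in _ *+ X]card_ord.
  rewrite -sumr_const ler_sum// => i _.
  have := young_dotv L^-1 (grad (fs i) x - grad (fs i) xs) (x - xs).
  rewrite invr_gt0 invrK => /(_ L_gt0).
  have : L^-1 * dotv (grad (fs i) x - grad (fs i) xs)
      (grad (fs i) x - grad (fs i) xs) <= L * dotv (x - xs) (x - xs).
    by rewrite ler_pdivrMl// mulrA -expr2; exact: smooth_dotvv.
  lra.
rewrite -(ler_pM2r D0); clearbody f; lra.
Qed.

End Objective.

(** Here [u] is [x_t - xs], [b] the averaged error scaled by the stepsize, and [u - b] the
    displacement of the virtual iterate; the gradient [g] is taken at [x_t]. Of the [2 F] supplied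
    by quasi-convexity, the mismatch between [g] and [b] uses [F / 2], the squared step uses
    [F / 4], and [F] is kept. The coefficient 10 is 8 from that mismatch plus 2 from moving the [mu]
    term from [u] to [u - b]. *)
Lemma descent_step {R : realType} {d : nat} (u b g : 'rV[R]_d) (F L mu a : R) :
  0 < L -> 0 < mu -> mu <= 2 * L -> 0 < a -> 16 * L * a <= 1 -> 0 <= F ->
  dotv g g <= 4 * L * F -> F + mu / 2 * dotv u u <= dotv g u ->
  dotv (u - b - a *: g) (u - b - a *: g) + a * F
    <= (1 - mu * a / 2) * dotv (u - b) (u - b) + 10 * L * a * dotv b b.
Proof.
move=> L0 mu0 muL a0 aL F0 gF qc.
have B0 := dotvv_ge0 b; have G0 := dotvv_ge0 g.
have ygb : 2 * dotv g b <= F / 2 + 8 * L * dotv b b.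
  have L80 : 0 < (8 * L)^-1 by rewrite invr_gt0 mulr_gt0.
  apply: le_trans (young_dotv _ g b L80) _; rewrite invrK lerD2r.
  rewrite ler_pdivrMl ?mulr_gt0//; lra.
have aG : a * dotv g g <= F / 4.
  apply: (@le_trans _ _ (a * (4 * L * F))); first by rewrite ler_pM2l.
  have -> : a * (4 * L * F) = (16 * L * a) * (F / 4) by field.
  by rewrite ler_piMl// divr_ge0.
have ub : dotv (u - b) (u - b) <= 2 * dotv u u + 2 * dotv b b.
  have := dotvv_ge0 (u + b); rewrite !dotvE (dotvC b u); lra.
have muub : mu / 2 * dotv (u - b) (u - b) <= mu * dotv u u + 2 * L * dotv b b.
  apply: (@le_trans _ _ (mu / 2 * (2 * dotv u u + 2 * dotv b b))).
    by rewrite ler_pM2l// divr_gt0.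
  have : mu * dotv b b <= 2 * L * dotv b b by rewrite ler_wpM2r.
  lra.
have : a * (- 2 * dotv g u + 2 * dotv g b + a * dotv g g + F
    + mu / 2 * dotv (u - b) (u - b) - 10 * L * dotv b b) <= 0.
  rewrite pmulr_rle0//; lra.
set w := u - b in ub muub *.
have -> : dotv g u = dotv w g + dotv g b by rewrite /w dotvC !dotvE (dotvC b g); ring.
clearbody w; rewrite !dotvE (dotvC g w); lra.
Qed.

(** * Fresh draws *)

(** On rectangles the law of the pair is the product of the law of [X] and [Q]; uniqueness of the
    product measure extends this to all sets, and Tonelli's theorem splits the integral. *)
Lemma ge0_integral_independent {R : realType} {d d1 d2 : measure_display}
    {Omega : measurableType d} {T1 : measurableType d1} {T2 : measurableType d2}
    (P : probability Omega R) (Q : probability T2 R)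
    (X : Omega -> T1) (Y : Omega -> T2) (h : T1 * T2 -> \bar R) :
  measurable_fun setT X -> measurable_fun setT Y ->
  (forall A B, measurable A -> measurable B ->
    P (X @^-1` A `&` Y @^-1` B) = (P (X @^-1` A) * Q B)%E) ->
  measurable_fun setT h -> (forall p, 0 <= h p)%E ->
  (\int[P]_w h (X w, Y w) = \int[P]_w \int[Q]_z h (X w, z))%E.
Proof.
move=> mX mY XY mh h0.
have mXY : measurable_fun setT (fun w => (X w, Y w)) by exact: measurable_fun_pair.
pose X' : {RV P >-> T1} := HB.pack X (isMeasurableFun.Build _ _ _ _ X mX).
pose XY' : {RV P >-> (T1 * T2)%type} := HB.pack (fun w => (X w, Y w))
  (isMeasurableFun.Build _ _ _ _ (fun w => (X w, Y w)) mXY).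
rewrite -[LHS]/(\int[P]_w (h \o XY') w)%E -ge0_integral_distribution//.
rewrite (eq_measure_integral (distribution P X' \x Q)%E); last first.
  by move=> A mA _; apply/esym; apply: product_measure_unique.
rewrite fubini_tonelli1// -[RHS]/(\int[P]_w (fubini_F Q h \o X') w)%E.
rewrite ge0_integral_distribution//; first exact: measurable_fun_fubini_tonelli_F.
by move=> x; exact: integral_ge0.
Qed.

Section Draws.
Context {R : realType} {n : nat} {dO dX : measure_display}.
Context {Omega : measurableType dO} {Xi : measurableType dX}.
Variables (P : probability Omega R) (PXi : probability Xi R).
Variable xi : draw_index n -> Omega -> Xi.
Hypothesis xi_iid : iid_draws P PXi xi.

(** A system of sets stable under intersection that generates the sigma-algebra of the draws indexed
    by [S]. *)
Definition draw_cylinders (S : pred (draw_index n)) : set (set Omega) :=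
  [set B | exists (s : seq (draw_index n)) (A : draw_index n -> set Xi),
    [/\ {in s, forall j, S j}, forall j, measurable (A j) &
        B = \bigcap_(j in [set` s]) xi j @^-1` A j]].

(** The sample space itself, with the coarser sigma-algebra of the draws in [S]. As a type of its
    own it makes dependence on these draws alone an ordinary measurability statement. *)
Definition past (S : pred (draw_index n)) := g_sigma_algebraType (draw_cylinders S).

Lemma draw_preimage_measurable j (A : set Xi) :
  measurable A -> measurable (xi j @^-1` A).
Proof. by move=> mA; rewrite -[X in measurable X]setTI; exact: xi_iid.1. Qed.

Lemma draw_cylinders_measurable S : draw_cylinders S `<=` measurable.
Proof.
move=> _ [s [A [_ mA ->]]]; rewrite bigcap_seq; apply: bigsetI_measurable.
by move=> j _; exact: draw_preimage_measurable.
Qed.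

Lemma draw_cylinders_setI S : setI_closed (draw_cylinders S).
Proof.
move=> _ _ [s [A [sS mA ->]]] [s' [A' [sS' mA' ->]]].
(* Outside its own list a family is replaced by the full set, so that both cylinders can be written
   over the concatenated list. *)
pose B (r : seq (draw_index n)) (C : draw_index n -> set Xi) j :=
  if j \in r then C j else setT.
have mB r C j : (forall j, measurable (C j)) -> measurable (B r C j).
  by move=> mC; rewrite /B; case: ifP.
exists (s ++ s'), (fun j => B s A j `&` B s' A' j); split.
- by move=> j; rewrite mem_cat => /orP[/sS|/sS'].
- by move=> j; apply: measurableI; exact: mB.
- apply/seteqP; split => w.
    move=> [Aw A'w] j _; split; rewrite /B; case: ifP => // js.
    + exact: Aw.
    + exact: A'w.
  move=> Bw; split => j js.
    have [] := Bw j; first by rewrite /= mem_cat js.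
    by move=> + _; rewrite /B js.
  have [] := Bw j; first by rewrite /= mem_cat js orbT.
  by move=> _; rewrite /B js.
Qed.

Lemma draw_cylinders_indep S k B (A : set Xi) : ~~ S k -> measurable A ->
  draw_cylinders S B -> P (B `&` xi k @^-1` A) = (P B * PXi A)%E.
Proof.
move=> Sk mA [s [C [sS mC ->]]].
(* Independence is stated for duplicate-free lists, and [k] must be new to the list in order to be
   prepended. *)
have ks : k \notin undup s by rewrite mem_undup; apply/negP => /sS; exact/negP.
have -> : \bigcap_(j in [set` s]) xi j @^-1` C j =
    \big[setI/setT]_(j <- undup s) (xi j @^-1` C j).
  rewrite -bigcap_seq (_ : [set` undup s] = [set` s])//.
  by apply/seteqP; split => j; rewrite /= mem_undup.
pose C' j := if j == k then A else C j.
have C'C j : j \in undup s -> C' j = C j.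
  by rewrite /C'; case: eqP => // ->; rewrite (negbTE ks).
have C'k : C' k = A by rewrite /C' eqxx.
have mC' j : measurable (C' j) by rewrite /C'; case: ifP.
have := xi_iid.2 (k :: undup s) C'; rewrite /= ks undup_uniq => /(_ isT mC').
rewrite !big_cons C'k [in X in X -> _]setIC.
rewrite (eq_big_seq (fun j => xi j @^-1` C j)); last by move=> j /C'C ->.
move=> ->; rewrite (eq_big_seq (fun j => PXi (C j))); last by move=> j /C'C ->.
by rewrite muleC; congr (_ * _)%E; rewrite xi_iid.2// undup_uniq.
Qed.

(** As functions of [B], both sides are finite measures. They agree on cylinders, hence on the
    generated sigma-algebra. *)
Lemma past_indep S k (B : set (past S)) (A : set Xi) : ~~ S k -> measurable A ->
  measurable B -> P (B `&` xi k @^-1` A) = (P B * PXi A)%E.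
Proof.
move=> Sk mA mB.
have mkA := draw_preimage_measurable k A mA.
have PA0 : 0 <= fine (PXi A) by rewrite fine_ge0.
have setT_cyl : draw_cylinders S setT.
  by exists [::], (fun=> setT); split => //; rewrite set_nil bigcap_set0.
have := @g_sigma_algebra_measure_unique _ R _ (draw_cylinders S)
  (draw_cylinders_measurable S) (fun=> setT) (fun=> setT_cyl)
  (bigcup_const setT (ex_intro _ 0%N I)) (mrestr P mkA) (mscale (NngNum PA0) P)
  (draw_cylinders_setI S).
have mscaleE C : mscale (NngNum PA0) P C = (P C * PXi A)%E.
  by rewrite /mscale /= fineK ?fin_num_measure// muleC.
move=> uniq; rewrite -mscaleE; apply: uniq mB.
- move=> C CS; apply: etrans (esym (mscaleE C)).
  exact: draw_cylinders_indep Sk mA CS.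
- move=> _; apply: le_lt_trans (ltry 1).
  by apply: probability_le1; exact: measurableI.
Qed.

Lemma past_measurable S (A : set (past S)) :
  measurable A -> measurable (A : set Omega).
Proof.
move: A; apply: smallest_sub; first exact: sigma_algebra_measurable.
exact: draw_cylinders_measurable.
Qed.

Lemma past_draw_measurable (S : pred (draw_index n)) j :
  S j -> measurable_fun setT (xi j : past S -> Xi).
Proof.
move=> Sj _ A mA; rewrite setTI; apply: sub_sigma_algebra.
exists [:: j], (fun=> A); split => //; first by move=> i; rewrite inE => /eqP ->.
by rewrite set_cons1 bigcap_set1.
Qed.

(** The substitute for conditioning: a bound on the mean over one draw, valid for each frozen past,
    may be integrated when that draw lies outside [S]. *)
Lemma le_integral_fresh_draw (S : pred (draw_index n)) k (h : past S * Xi -> R)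
    (b : Omega -> R) :
  ~~ S k -> measurable_fun setT h -> measurable_fun setT b ->
  (forall p, 0 <= h p) ->
  (forall w, (\int[PXi]_z (h (w, z))%:E <= (b w)%:E)%E) ->
  (\int[P]_w (h (w, xi k w))%:E <= \int[P]_w (b w)%:E)%E.
Proof.
move=> Sk mh mb h0 hb.
(* The identity, read as a random variable with values in the coarser space. *)
pose X w : past S := w.
have mX : measurable_fun (setT : set Omega) X.
  by move=> _ A mA; rewrite setTI; exact: (past_measurable S A mA).
have mEh : measurable_fun setT (EFin \o h) by exact/measurable_EFinP.
have Eh0 p : (0 <= (EFin \o h) p)%E by rewrite lee_fin.
have mF : measurable_fun setT (fubini_F PXi (EFin \o h)).
  exact: measurable_fun_fubini_tonelli_F.
have := ge0_integral_independent P PXi X (xi k) (EFin \o h) mX (xi_iid.1 k).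
rewrite /= => ->//; last by move=> A B mA mB; exact: (past_indep S k A B Sk mB mA).
apply: ge0_le_integral => //.
- by move=> w _; apply: integral_ge0 => z _; rewrite lee_fin.
- exact: (measurableT_comp mF mX).
- exact/measurable_EFinP.
Qed.

End Draws.

(** * Measurability of vector-valued maps *)

Section VecMeasurable.
Context {R : realType} {d : nat} {dT : measure_display} {T : measurableType dT}.
Implicit Types X Y : T -> 'rV[R]_d.

Lemma vec_measurable_cst (v : 'rV[R]_d) : vec_measurable (fun _ : T => v).
Proof. by move=> j; exact: measurable_cst. Qed.

Lemma vec_measurableD X Y : vec_measurable X -> vec_measurable Y ->
  vec_measurable (fun w => X w + Y w).
Proof.
move=> mX mY j; under eq_fun do rewrite mxE.
exact: measurable_funD (mX j) (mY j).
Qed.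

Lemma vec_measurableZ a X : vec_measurable X -> vec_measurable (fun w => a *: X w).
Proof.
move=> mX j; under eq_fun do rewrite mxE.
exact: measurable_funM (measurable_cst _) (mX j).
Qed.

Lemma vec_measurableB X Y : vec_measurable X -> vec_measurable Y ->
  vec_measurable (fun w => X w - Y w).
Proof.
move=> mX mY; under eq_fun do rewrite -scaleN1r.
exact/vec_measurableD/vec_measurableZ.
Qed.

Lemma vec_measurable_sum (I : eqType) (r : seq I) (F : I -> T -> 'rV[R]_d) :
  (forall i, i \in r -> vec_measurable (F i)) ->
  vec_measurable (fun w => \sum_(i <- r) F i w).
Proof.
elim: r => [_|i r IH mF].
  by under eq_fun do rewrite big_nil; exact: vec_measurable_cst.
under eq_fun do rewrite big_cons.
apply: vec_measurableD; first by apply: mF; exact: mem_head.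
by apply: IH => k kr; apply: mF; rewrite in_cons kr orbT.
Qed.

Lemma measurable_dotv X Y : vec_measurable X -> vec_measurable Y ->
  measurable_fun setT (fun w => dotv (X w) (Y w)).
Proof.
by move=> mX mY; apply: measurable_sum => j; apply: measurable_funM.
Qed.

(** A preimage is the countable union of the fibres of [K] over the values that [g] sends into the
    set. *)
Lemma measurable_countable_comp (U : countType) (K : T -> U) (g : U -> R) :
  (forall u, measurable [set w | K w = u]) -> measurable_fun setT (g \o K).
Proof.
move=> mK _ B mB; rewrite setTI.
rewrite (_ : _ @^-1` B = \bigcup_u ([set w | K w = u] `&` [set _ | B (g u)])).
  apply: countable_bigcupT_measurable => // u; apply: measurableI => //.
  have [Bu|nBu] := pselect (B (g u)).
    by rewrite (_ : [set _ | _] = setT)//; apply/seteqP; split.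
  by rewrite (_ : [set _ | _] = set0)//; apply/seteqP; split.
by apply/seteqP; split => [w Bw|w [u _ [/= -> //]]]; exists (K w).
Qed.

(* [f \o X] is the pointwise limit of [f] evaluated at [X] rounded down to the
   grid of mesh [1/(m+1)], which takes countably many values. *)
Lemma continuous_vec_measurable (f : 'rV[R]_d -> R) X :
  continuous f -> vec_measurable X -> measurable_fun setT (fun w => f (X w)).
Proof.
move=> cf mX.
pose K m w : 'rV[int]_d := \row_j Num.floor (X w 0 j * m.+1%:R).
pose r m (k : 'rV[int]_d) : 'rV[R]_d := \row_j ((k 0 j)%:~R / m.+1%:R).
apply: (@measurable_fun_cvg _ _ _ _ (fun m => (f \o r m) \o K m)).
  move=> m; apply: measurable_countable_comp => k.
  rewrite (_ : [set w | _] = \bigcap_(j in [set: 'I_d])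
      ((fun w => X w 0 j * m.+1%:R) @^-1` [set` `[(k 0 j)%:~R, (k 0 j + 1)%:~R[])).
    apply: fin_bigcap_measurable => // j _.
    rewrite -[X in measurable X]setTI.
    exact: (measurable_funM (mX j) (measurable_cst _)).
  apply/seteqP; split => w /=.
    by move=> <- j _; rewrite /= in_itv /= mxE floor_itv.
  move=> Kw; apply/rowP => j; rewrite mxE; apply: floor_def.
  by have := Kw j Logic.I; rewrite /= in_itv.
move=> w _; apply: continuous_cvg; first exact: cf.
apply/cvgrPdist_lt => e e0; near=> m.
rewrite /Num.Def.normr /= mx_normrE; apply: bigmax_lt => // -[i j] _ /=.
rewrite !mxE ord1; set y := X w 0 j.
have m0 : 0 < m.+1%:R :> R by [].
have : `|y * m.+1%:R - (Num.floor (y * m.+1%:R))%:~R| <= 1.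
  have /andP[l u] := floor_itv (y * m.+1%:R).
  by rewrite ger0_norm ?subr_ge0// lerBlDl (le_trans (ltW u))// intrD.
have -> : y - (Num.floor (y * m.+1%:R))%:~R / m.+1%:R =
    (y * m.+1%:R - (Num.floor (y * m.+1%:R))%:~R) / m.+1%:R.
  by rewrite mulrBl mulfK ?gt_eqF.
rewrite normrM normfV (gtr0_norm m0) => le1.
apply: (@le_lt_trans _ _ m.+1%:R^-1); first by rewrite ler_piMl.
by near: m; exact: near_infty_natSinv_lt (PosNum e0).
Unshelve. all: by end_near. Qed.

End VecMeasurable.

(** Continuity is what makes gradients along the iterates measurable. Passing from the Euclidean to
    the max norm costs a factor [d]. *)
Lemma smooth_grad_continuous {R : realType} {d : nat} (L : R)
    (f : 'rV[R]_d -> R) j : 0 < L -> smooth_fun L f ->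
  continuous (fun x => grad f x 0 j).
Proof.
(* The added 1 keeps the divisor positive in dimension 0. *)
move=> L0 sf x; have Ld0 : 0 < L * d%:R + 1.
  by rewrite ltr_wpDl// mulr_ge0// ltW.
apply/(@cvgrPdist_lt _ _ _ (nbhs x)) => e e0; near=> y.
have xy : `|x - y| < e / (L * d%:R + 1).
  near: y; apply/(@nbhs_ballP R); exists (e / (L * d%:R + 1)).
    exact: divr_gt0.
  by move=> y; rewrite -ball_normE.
apply: le_lt_trans (enorm_coordB_le _ _ j) _; apply: le_lt_trans (sf x y) _.
have coord k : `|(x - y) 0 k| <= `|x - y|.
  rewrite [leRHS]/Num.Def.normr /= mx_normrE.
  exact: (le_bigmax _ (fun ij => `|(x - y) ij.1 ij.2|) (0, k)).
have xyd : enorm (x - y) <= d%:R * `|x - y|.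
  apply: le_trans (enorm_le_sum _) _.
  rewrite mulr_natl -[X in _ *+ X]card_ord -sumr_const.
  by apply: ler_sum => k _; exact: coord.
apply: (@le_lt_trans _ _ (L * (d%:R * `|x - y|))); first by rewrite ler_pM2l.
rewrite -(ltr_pM2l Ld0) mulrCA divff ?gt_eqF// mulr1 in xy.
apply: le_lt_trans xy; rewrite mulrA mulrDl lerDl mul1r; exact: normr_ge0.
Unshelve. all: by end_near. Qed.

(** * Moments of one draw and measurability of the trajectory *)

Lemma probability_integral_cst {R : realType} {dT : measure_display}
    {T : measurableType dT} (Q : probability T R) (r : R) :
  (\int[Q]_x r%:E = r%:E)%E.
Proof.
rewrite integral_cst// -[RHS]mule1; congr (_ * _)%E; exact: probability_setT.
Qed.

(** After expanding the square, the cross term integrates to 0 because [N] is centered. The finite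
    second moment supplies the integrability needed to split the integral. *)
Lemma centered_second_moment_le {R : realType} {d : nat} {dX : measure_display}
    {Xi : measurableType dX} (Q : probability Xi R) (N : Xi -> 'rV[R]_d)
    (v : 'rV[R]_d) (c s2 : R) :
  vec_measurable N ->
  (forall j, Q.-integrable setT (fun z => (N z 0 j)%:E)) ->
  (forall j, \int[Q]_z (N z 0 j)%:E = 0)%E ->
  (\int[Q]_z (dotv (N z) (N z))%:E <= s2%:E)%E ->
  (\int[Q]_z (dotv (v + c *: N z) (v + c *: N z))%:E
     <= (dotv v v + c ^+ 2 * s2)%:E)%E.
Proof.
move=> mN iN N0 Ns2.
have mNN : measurable_fun setT (fun z => dotv (N z) (N z)).
  exact: measurable_dotv.
have iNN : Q.-integrable setT (fun z => (dotv (N z) (N z))%:E).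
  apply/integrableP; split; first exact/measurable_EFinP.
  under eq_integral do rewrite gee0_abs ?lee_fin ?dotvv_ge0//.
  exact: le_lt_trans Ns2 (ltry _).
have vNE z : ((dotv v (N z))%:E = \sum_j (v 0 j)%:E * (N z 0 j)%:E)%E.
  by rewrite /dotv -sumEFin; apply: eq_bigr => j _; rewrite EFinM.
have iv j : Q.-integrable setT (fun z => (v 0 j)%:E * (N z 0 j)%:E)%E.
  exact: integrableZl.
have ivN : Q.-integrable setT (fun z => (dotv v (N z))%:E).
  under eq_fun do rewrite vNE; exact: integrable_sum.
have vN0 : (\int[Q]_z (dotv v (N z))%:E = 0)%E.
  under eq_integral do rewrite vNE.
  rewrite integral_sum// big1// => j _.
  by rewrite integralZl// N0 mule0.
have E z : ((dotv (v + c *: N z) (v + c *: N z))%:E =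
    ((dotv v v)%:E + (2 * c)%:E * (dotv v (N z))%:E)
      + (c ^+ 2)%:E * (dotv (N z) (N z))%:E)%E.
  by rewrite -!EFinM -!EFinD !dotvE (dotvC (N z) v); congr (_%:E); ring.
under eq_integral do rewrite E.
have icst : Q.-integrable setT (fun=> (dotv v v)%:E).
  exact: finite_measure_integrable_cst.
have i2 : Q.-integrable setT (fun z => (2 * c)%:E * (dotv v (N z))%:E)%E.
  exact: integrableZl.
rewrite integralD//; [|exact: integrableD|exact: integrableZl].
rewrite integralD// !integralZl// vN0 mule0 adde0 EFinD.
rewrite probability_integral_cst [(c ^+ 2 * s2)%:E]EFinM.
apply: leeD2l; apply: lee_pmul; rewrite ?lee_fin ?sqr_ge0//.
by apply: integral_ge0 => z _; rewrite lee_fin dotvv_ge0.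
Qed.

(** The state after [t] iterations reads only draws of earlier iterations. The domain [T] is
    arbitrary so that the result applies to [past] as well as to [Omega]. *)
Lemma ec_ideal_measurable {R : realType} {d n : nat} {dT dX : measure_display}
    {T : measurableType dT} {Xi : measurableType dX}
    (G : 'I_n -> 'rV[R]_d -> Xi -> 'rV[R]_d) (C : 'rV[R]_d -> Xi -> 'rV[R]_d)
    (zeta : draw_index n -> T -> Xi) hs gamma x0 t :
  (forall i, jointly_measurable (G i)) -> jointly_measurable C ->
  (forall j : draw_index n, (j.1.1 < t)%N -> measurable_fun setT (zeta j)) ->
  vec_measurable (fun w => (ec_ideal G C zeta hs gamma x0 t w).1) /\
  (forall i, vec_measurable (fun w => (ec_ideal G C zeta hs gamma x0 t w).2 i)).
Proof.
move=> mG mC; elim: t => [_|t IH mz]; first by split=> [|i]; exact: vec_measurable_cst.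
have [|mx me] := IH; first by move=> j jt; apply: mz; exact: ltnW.
have mg i : vec_measurable (fun w => (ec_ideal G C zeta hs gamma x0 t w).2 i +
    G i (ec_ideal G C zeta hs gamma x0 t w).1 (zeta (t, i, false) w) - hs i).
  apply: vec_measurableB; last exact: vec_measurable_cst.
  by apply: vec_measurableD => //; apply: mG => //; apply: mz; exact: ltnSn.
have mD i : vec_measurable (fun w => C ((ec_ideal G C zeta hs gamma x0 t w).2 i +
    G i (ec_ideal G C zeta hs gamma x0 t w).1 (zeta (t, i, false) w) - hs i)
    (zeta (t, i, true) w)).
  by apply: mC => //; apply: mz; exact: ltnSn.
split => [|i] /=; last exact: vec_measurableB.
apply: vec_measurableB; last by apply/vec_measurableZ/vec_measurable_sum => i _.
by apply: vec_measurableB => //; exact: vec_measurable_cst.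
Qed.

(** * One step of EC-Ideal *)

(** Young's inequality with weight [delta / 2], then [(1 - delta)(1 + delta/2) <= 1 - delta/2] and
    [(1 - delta)(1 + 2/delta) <= 2/delta]. *)
Lemma compression_error_step {R : realType} {d : nat} (e v : 'rV[R]_d)
    (delta s2 : R) : 0 < delta <= 1 -> 0 <= s2 ->
  (1 - delta) * (dotv (e + v) (e + v) + s2)
    <= (1 - delta / 2) * dotv e e + 2 / delta * dotv v v + s2.
Proof.
move=> /andP[d0 d1] s0.
have E0 := dotvv_ge0 e; have V0 := dotvv_ge0 v.
have d20 : 0 < delta / 2 by rewrite divr_gt0.
have := young_dotv (delta / 2) e v d20; rewrite invf_div => y.
have ev : dotv (e + v) (e + v) <=
    (1 + delta / 2) * dotv e e + (1 + 2 / delta) * dotv v v.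
  rewrite !dotvE (dotvC v e); lra.
apply: (@le_trans _ _ ((1 - delta) * ((1 + delta / 2) * dotv e e
    + (1 + 2 / delta) * dotv v v + s2))).
  by rewrite ler_wpM2l ?subr_ge0// lerD2r.
rewrite -subr_ge0.
rewrite (_ : _ - _ = delta ^+ 2 / 2 * dotv e e + (1 + delta) * dotv v v
   + delta * s2); last by field; rewrite gt_eqF.
by rewrite !addr_ge0// mulr_ge0// ?divr_ge0 ?exprn_ge0 ?addr_ge0// ltW.
Qed.

(** Nonnegativity stands in for integrability: the moments of the iterates are shown to be finite
    only after the recursions for them. *)
Lemma ge0_integral_lincomb {R : realType} {dT : measure_display}
    {T : measurableType dT} (m : {measure set T -> \bar R}) (a b : T -> R) (p q : R) :
  measurable_fun setT a -> measurable_fun setT b ->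
  (forall w, 0 <= a w) -> (forall w, 0 <= b w) -> 0 <= p -> 0 <= q ->
  (\int[m]_w (p * a w + q * b w)%:E
    = p%:E * \int[m]_w (a w)%:E + q%:E * \int[m]_w (b w)%:E)%E.
Proof.
move=> ma mb a0 b0 p0 q0.
have mE (g : T -> R) : measurable_fun setT g ->
  measurable_fun setT (fun w => (g w)%:E) by move=> mg; exact/measurable_EFinP.
rewrite -!ge0_integralZl ?lee_fin//; try exact: mE; try by move=> w _; rewrite lee_fin.
rewrite -ge0_integralD//.
- by move=> w _; rewrite -EFinM lee_fin mulr_ge0.
- exact/mE/measurable_funM.
- by move=> w _; rewrite -EFinM lee_fin mulr_ge0.
- exact/mE/measurable_funM.
Qed.

Lemma ge0_integral_avg {R : realType} {n : nat} {dT : measure_display}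
    {T : measurableType dT} (m : {measure set T -> \bar R}) (a : 'I_n -> T -> R) (p : R) :
  (forall i, measurable_fun setT (a i)) -> (forall i w, 0 <= a i w) -> 0 <= p ->
  (\int[m]_w (p * \sum_i a i w)%:E = p%:E * \sum_i \int[m]_w (a i w)%:E)%E.
Proof.
move=> ma a0 p0; under eq_integral do rewrite EFinM.
rewrite ge0_integralZl ?lee_fin//.
- congr (_ * _)%E; under eq_integral do rewrite -sumEFin.
  rewrite ge0_integral_sum// => [i|i w _]; first exact/measurable_EFinP.
  by rewrite lee_fin.
- by apply/measurable_EFinP; exact: measurable_sum.
- by move=> w _; rewrite lee_fin sumr_ge0.
Qed.

(** The messages [D] and the shifts [h] cancel between the server step and the updated errors. What
    remains is a gradient step, with each [g i] split into its mean [u i] and its noise. *)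
Lemma virtual_iterate_algebra {R : realType} {d n : nat} (y xs : 'rV[R]_d)
    (e g h D u : 'I_n -> 'rV[R]_d) (gamma : R) :
  y - gamma *: (n%:R^-1 *: \sum_i h i) - (gamma / n%:R) *: \sum_i D i
    - (gamma / n%:R) *: \sum_i (e i + g i - h i - D i) - xs
  = y - (gamma / n%:R) *: \sum_i e i - xs - gamma *: (n%:R^-1 *: \sum_i u i)
    + \sum_i (- (gamma / n%:R)) *: (g i - u i).
Proof.
rewrite -scaler_sumr !sumrB big_split /= !scalerA.
move: (\sum_i u i) (\sum_i h i) (\sum_i e i) (\sum_i g i) (\sum_i D i).
by move=> a b c v s; apply/rowP => j; rewrite !mxE; ring.
Qed.

Section EcIdeal.
Context {R : realType} {d n : nat} {dO dX : measure_display}.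
Context {Omega : measurableType dO} {Xi : measurableType dX}.
Variables (P : probability Omega R) (PXi : probability Xi R).
Variable xi : draw_index n -> Omega -> Xi.
Variables (fs : 'I_n -> 'rV[R]_d -> R) (xs x0 : 'rV[R]_d).
Variables (mu L delta sigma gamma : R).
Variables (G : 'I_n -> 'rV[R]_d -> Xi -> 'rV[R]_d) (C : 'rV[R]_d -> Xi -> 'rV[R]_d).
Hypotheses (n_gt0 : (0 < n)%N) (mu_gt0 : 0 < mu) (L_gt0 : 0 < L).
Hypothesis delta01 : 0 < delta <= 1.
Hypothesis fs_diff : forall i, differentiable_everywhere (fs i).
Hypothesis fs_convex : forall i, convex_fun (fs i).
Hypothesis fs_smooth : forall i, smooth_fun L (fs i).
Hypothesis xs_min : forall x, avg_fun fs xs <= avg_fun fs x.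
Hypothesis f_qconvex : strongly_quasi_convex mu (avg_fun fs) xs.
Hypothesis G_measurable : forall i, jointly_measurable (G i).
Hypothesis C_measurable : jointly_measurable C.
Hypothesis G_unbiased : forall i x j,
  PXi.-integrable setT (fun z => (G i x z 0 j)%:E) /\
  (\int[PXi]_z (G i x z 0 j)%:E = (grad (fs i) x 0 j)%:E)%E.
Hypothesis G_variance : forall i x,
  (\int[PXi]_z ((enorm (G i x z - grad (fs i) x)) ^+ 2)%:E <= (sigma ^+ 2)%:E)%E.
Hypothesis C_contractive : forall v,
  (\int[PXi]_z ((enorm (C v z - v)) ^+ 2)%:E <= ((1 - delta) * enorm v ^+ 2)%:E)%E.
Hypothesis xi_iid : iid_draws P PXi xi.
Hypotheses (gamma_gt0 : 0 < gamma) (muL : mu <= 2 * L).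
Hypothesis gammaL : 16 * L * gamma <= 1.

Let f := avg_fun fs.
Let h i := grad (fs i) xs.
Let x t w := (ec_ideal G C xi h gamma x0 t w).1.
Let e i t w := (ec_ideal G C xi h gamma x0 t w).2 i.
Let noise i y z := G i y z - grad (fs i) y.
Let virtual t w := x t w - (gamma / n%:R) *: \sum_i e i t w.
Let dist2 t w := dotv (virtual t w - xs) (virtual t w - xs).
Let err t w := n%:R^-1 * \sum_i dotv (e i t w) (e i t w).
Let gap t w := f (x t w) - f xs.

(** [S] may also hold draws of iteration [t] itself, those already revealed when a further one is
    integrated out. *)
Let contains_past (S : pred (draw_index n)) (t : nat) :=
  forall j : draw_index n, (j.1.1 < t)%N -> S j.

Let past_vec S (U : Omega -> 'rV[R]_d) := @vec_measurable R d _ (past xi S) U.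

(** The two sides differ only in the measurable structure put on [Omega], which the recursion never
    inspects. *)
Lemma ec_ideal_past S t w :
  ec_ideal G C xi h gamma x0 t w =
  @ec_ideal R d n _ dX (past xi S) Xi G C xi h gamma x0 t w.
Proof. by elim: t => //= t ->. Qed.

Lemma x_past S t : contains_past S t -> past_vec S (x t).
Proof.
move=> St j; rewrite /x; under eq_fun do rewrite (ec_ideal_past S).
apply: (ec_ideal_measurable G C _ _ _ _ _ G_measurable C_measurable _).1.
by move=> k kt; apply: past_draw_measurable; exact: St.
Qed.

Lemma e_past S t i : contains_past S t -> past_vec S (e i t).
Proof.
move=> St j; rewrite /e; under eq_fun do rewrite (ec_ideal_past S).
apply: (ec_ideal_measurable G C _ _ _ _ _ G_measurable C_measurable _).2.
by move=> k kt; apply: past_draw_measurable; exact: St.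
Qed.

Lemma grad_vec_measurable {dT} {T : measurableType dT} i (X : T -> 'rV[R]_d) :
  vec_measurable X -> vec_measurable (fun w => grad (fs i) (X w)).
Proof.
move=> mX j; apply: (@continuous_vec_measurable _ _ _ _ (fun y => grad (fs i) y 0 j)) => //.
exact: smooth_grad_continuous L_gt0 (fs_smooth i).
Qed.

Lemma noise_vec_measurable {dT} {T : measurableType dT} i
    (X : T -> 'rV[R]_d) (Z : T -> Xi) :
  vec_measurable X -> measurable_fun setT Z ->
  vec_measurable (fun w => noise i (X w) (Z w)).
Proof.
move=> mX mZ; apply: vec_measurableB; first exact: G_measurable.
exact: grad_vec_measurable.
Qed.

Lemma past_vec_measurable S (U : Omega -> 'rV[R]_d) :
  past_vec S U -> vec_measurable U.
Proof.
move=> mU j _ B mB; rewrite setTI.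
apply: (past_measurable P PXi xi xi_iid S).
by rewrite -[X in measurable X]setTI; exact: mU.
Qed.

Lemma noise_moment_le i y v c :
  (\int[PXi]_z (dotv (v + c *: noise i y z) (v + c *: noise i y z))%:E
     <= (dotv v v + c ^+ 2 * sigma ^+ 2)%:E)%E.
Proof.
have iG j := (G_unbiased i y j).1.
have icst (r : R) : PXi.-integrable setT (fun=> r%:E).
  exact: finite_measure_integrable_cst.
have noiseE j z : ((noise i y z 0 j)%:E =
    (G i y z 0 j)%:E - (grad (fs i) y 0 j)%:E)%E.
  by rewrite -EFinB /noise; congr (_%:E); rewrite mxE [X in _ + X]mxE.
apply: centered_second_moment_le.
- by apply: noise_vec_measurable => //; exact: vec_measurable_cst.
- by move=> j; under eq_fun do rewrite noiseE; exact: integrableB.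
- move=> j; under eq_integral do rewrite noiseE.
  rewrite integralB// (G_unbiased i y j).2 probability_integral_cst.
  by rewrite -EFinB subrr.
- by under eq_integral do rewrite -sqr_enorm; exact: G_variance.
Qed.

Lemma compression_moment_le v :
  (\int[PXi]_z (dotv (C v z - v) (C v z - v))%:E <= ((1 - delta) * dotv v v)%:E)%E.
Proof.
by rewrite -[dotv v v]sqr_enorm; under eq_integral do rewrite -sqr_enorm;
  exact: C_contractive.
Qed.

(** The noises are integrated out one client at a time, each with the remaining ones frozen, so
    variances add without cross terms. This is the source of the factor [1/n] in the noise. *)
Lemma fresh_noise_le t (s : seq 'I_n) (U : Omega -> 'rV[R]_d) c : uniq s ->
  (forall S, contains_past S t -> past_vec S U) ->
  let V w := U w + \sum_(i <- s) c *: noise i (x t w) (xi (t, i, false) w) in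
  (\int[P]_w (dotv (V w) (V w))%:E
    <= \int[P]_w (dotv (U w) (U w))%:E
       + ((size s)%:R * (c ^+ 2 * sigma ^+ 2))%:E)%E.
Proof.
move=> us mU /=; elim: s us => [_|i s IH /= /andP[si us]].
  rewrite mul0r adde0; under eq_integral do rewrite big_nil addr0.
  exact: lexx.
(* All earlier iterations, plus the oracle draws of the clients in the tail [s]; [uniq] keeps the
   draw of [i] outside. *)
pose S (j : draw_index n) :=
  (j.1.1 < t)%N || [&& j.1.1 == t, j.1.2 \in s & ~~ j.2].
have St : contains_past S t by move=> j jt; rewrite /S jt.
pose V w := U w + \sum_(i <- s) c *: noise i (x t w) (xi (t, i, false) w).
have mV : past_vec S V.
  rewrite /V; apply: vec_measurableD; first exact: mU.
  apply: vec_measurable_sum => k ks.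
  apply: vec_measurableZ; apply: noise_vec_measurable; first exact: x_past.
  by apply: past_draw_measurable; rewrite /S/= eqxx ks orbT.
have mVO : measurable_fun setT (fun w => dotv (V w) (V w)).
  by apply: measurable_dotv; exact: past_vec_measurable mV.
pose H (p : past xi S * Xi) := dotv (V p.1 + c *: noise i (x t p.1) p.2)
  (V p.1 + c *: noise i (x t p.1) p.2).
have fstm (Y : Omega -> 'rV[R]_d) : past_vec S Y ->
    vec_measurable (fun p : past xi S * Xi => Y p.1).
  by move=> mY j; exact: (measurableT_comp (mY j) measurable_fst).
have mH : measurable_fun setT H.
  have mVc : vec_measurable (fun p : past xi S * Xi =>
      V p.1 + c *: noise i (x t p.1) p.2).
    apply: vec_measurableD; first exact: (fstm V).
    apply: vec_measurableZ; apply: noise_vec_measurable => //.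
    by apply: (fstm (x t)); exact: x_past.
  exact: measurable_dotv.
have step : (\int[P]_w (H (w, xi (t, i, false) w))%:E
    <= \int[P]_w (dotv (V w) (V w) + c ^+ 2 * sigma ^+ 2)%:E)%E.
  apply: (le_integral_fresh_draw P PXi xi xi_iid S) mH _ _ _.
  - by rewrite /S /= ltnn eqxx (negbTE si).
  - exact: measurable_funD.
  - by move=> p; exact: dotvv_ge0.
  - by move=> w; exact: (noise_moment_le i (x t w) (V w) c).
have HE w : dotv (U w + \sum_(k <- i :: s) c *: noise k (x t w) (xi (t, k, false) w))
    (U w + \sum_(k <- i :: s) c *: noise k (x t w) (xi (t, k, false) w)) =
    H (w, xi (t, i, false) w).
  by rewrite /H /V /= big_cons addrCA addrC.
under eq_integral do rewrite HE.
apply: le_trans step _.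
under eq_integral do rewrite -[dotv _ _]mul1r -[c ^+ 2 * _]mul1r.
rewrite ge0_integral_lincomb//; last 2 first.
- by move=> w; exact: dotvv_ge0.
- by move=> w; rewrite mulr_ge0// sqr_ge0.
rewrite !mul1e probability_integral_cst.
apply: le_trans (leeD2r _ (IH us)) _.
by rewrite -addeA -EFinD -natr1 [in leRHS]mulrDl mul1r.
Qed.

Lemma x_measurable t : vec_measurable (x t).
Proof. by apply: (past_vec_measurable xpredT); exact: x_past. Qed.

Lemma e_measurable i t : vec_measurable (e i t).
Proof. by apply: (past_vec_measurable xpredT); exact: e_past. Qed.

Lemma virtual_past S t : contains_past S t -> past_vec S (virtual t).
Proof.
move=> St; apply: vec_measurableB; first exact: x_past.
by apply/vec_measurableZ/vec_measurable_sum => i _; exact: e_past.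
Qed.

Lemma dist2_measurable t : measurable_fun setT (dist2 t).
Proof.
have mv : vec_measurable (virtual t).
  by apply: (past_vec_measurable xpredT); exact: virtual_past.
by apply: measurable_dotv; apply: vec_measurableB => //; exact: vec_measurable_cst.
Qed.

Lemma err_measurable t : measurable_fun setT (err t).
Proof.
apply: measurable_funM => //; apply: measurable_sum => i.
by apply: measurable_dotv; exact: e_measurable.
Qed.

Lemma gap_measurable t : measurable_fun setT (gap t).
Proof.
apply: measurable_funB => //; apply: continuous_vec_measurable (x_measurable t).
by move=> y; apply: differentiable_continuous; exact: avg_fun_differentiable.
Qed.

Lemma dist2_ge0 t w : 0 <= dist2 t w. Proof. exact: dotvv_ge0. Qed.

Lemma err_ge0 t w : 0 <= err t w.
Proof. by rewrite mulr_ge0// sumr_ge0// => i _; exact: dotvv_ge0. Qed.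

Lemma gap_ge0 t w : 0 <= gap t w.
Proof. by rewrite subr_ge0; exact: xs_min. Qed.

Lemma virtual_step t w :
  virtual t.+1 w - xs = virtual t w - xs - gamma *: grad f (x t w)
    + \sum_i (- (gamma / n%:R)) *: noise i (x t w) (xi (t, i, false) w).
Proof.
by rewrite (grad_avg_fun _ fs_diff); exact: virtual_iterate_algebra.
Qed.

Lemma dist2_step t :
  (\int[P]_w (dist2 t.+1 w)%:E + gamma%:E * \int[P]_w (gap t w)%:E <=
   (1 - mu * gamma / 2)%:E * \int[P]_w (dist2 t w)%:E
   + (10 * L * gamma ^+ 3)%:E * \int[P]_w (err t w)%:E
   + (gamma ^+ 2 * sigma ^+ 2 / n%:R)%:E)%E.
Proof.
pose U w := virtual t w - xs - gamma *: grad f (x t w).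
have mU S : contains_past S t -> past_vec S U.
  move=> St; apply: vec_measurableB.
    by apply: vec_measurableB; [exact: virtual_past|exact: vec_measurable_cst].
  apply: vec_measurableZ.
  have -> : (fun w => grad f (x t w)) = fun w => n%:R^-1 *: \sum_i grad (fs i) (x t w).
    by apply/funext => w; exact: grad_avg_fun.
  apply/vec_measurableZ/vec_measurable_sum => i _.
  by apply: grad_vec_measurable; exact: x_past.
have mUO : measurable_fun setT (fun w => dotv (U w) (U w)).
  by apply: measurable_dotv; apply: (past_vec_measurable xpredT); exact: mU.
have noise_le := fresh_noise_le t (index_enum 'I_n) U (- (gamma / n%:R))
  (index_enum_uniq _) mU.
have n0 : n%:R != 0 :> R by rewrite pnatr_eq0 -lt0n.
(* There are [n] independent noises, each scaled by [gamma / n]. *)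
have -> : gamma ^+ 2 * sigma ^+ 2 / n%:R =
    (size (index_enum 'I_n))%:R * ((- (gamma / n%:R)) ^+ 2 * sigma ^+ 2).
  by rewrite -[index_enum _]enumT size_enum_ord; field.
have descent w : 1 * dotv (U w) (U w) + gamma * gap t w <=
    (1 - mu * gamma / 2) * dist2 t w + 10 * L * gamma ^+ 3 * err t w.
  rewrite mul1r.
  have xsx : strongly_quasi_convex mu f xs by [].
  have := xsx (x t w); rewrite sqr_enorm => qc.
  have FG := grad_avg_fun_le fs L xs n_gt0 L_gt0 fs_diff fs_convex fs_smooth xs_min (x t w).
  (* By Jensen [|b|^2] is at most [gamma^2] times [err], which turns the coefficient [10 L gamma]
     into [10 L gamma^3]. *)
  pose b := (gamma / n%:R) *: \sum_i e i t w.
  have bE : dotv b b <= gamma ^+ 2 * err t w.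
    rewrite /b -scalerA dotvZl dotvZr mulrA -expr2 ler_wpM2l ?sqr_ge0//.
    exact: dotvv_avg_le.
  have qc' : gap t w + mu / 2 * dotv (x t w - xs) (x t w - xs)
      <= dotv (grad f (x t w)) (x t w - xs).
    by move: qc; rewrite -(opprB (x t w)) dotvNr dotvNl dotvNr opprK /gap; lra.
  have := @descent_step R d (x t w - xs) b (grad f (x t w)) (gap t w) L mu gamma
    L_gt0 mu_gt0 muL gamma_gt0 gammaL (gap_ge0 t w) FG qc'.
  rewrite [x t w - xs - b]addrAC => /le_trans; apply.
  rewrite /dist2 lerD2l (_ : _ * err t w = 10 * L * gamma * (gamma ^+ 2 * err t w)).
    by rewrite ler_pM2l// !mulr_gt0.
  by ring.
have int_descent : (\int[P]_w (dotv (U w) (U w))%:E + gamma%:E * \int[P]_w (gap t w)%:E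
    <= (1 - mu * gamma / 2)%:E * \int[P]_w (dist2 t w)%:E
   + (10 * L * gamma ^+ 3)%:E * \int[P]_w (err t w)%:E)%E.
  have rho0 : 0 <= 1 - mu * gamma / 2.
    have : mu * gamma <= 2 * L * gamma by rewrite ler_pM2r.
    by move: gammaL; lra.
  have c0 : 0 <= 10 * L * gamma ^+ 3 by rewrite !mulr_ge0 ?exprn_ge0// ltW.
  rewrite -[X in (X + _ <= _)%E]mul1e.
  rewrite -!ge0_integral_lincomb ?(ltW gamma_gt0)//;
    try exact: gap_measurable; try exact: dist2_measurable; try exact: err_measurable;
    try exact: gap_ge0; try exact: dist2_ge0; try exact: err_ge0;
    try by move=> w; exact: dotvv_ge0.
  apply: ge0_le_integral => //.
  - move=> w _; rewrite lee_fin addr_ge0// mulr_ge0 ?dotvv_ge0 ?gap_ge0// ltW//.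
  - apply/measurable_EFinP; apply: measurable_funD; apply: measurable_funM => //.
    exact: gap_measurable.
  - apply/measurable_EFinP; apply: measurable_funD; apply: measurable_funM => //.
      exact: dist2_measurable.
    exact: err_measurable.
  - by move=> w _; rewrite lee_fin; exact: descent.
apply: le_trans (leeD2r _ int_descent).
rewrite [leRHS]addeAC; apply: leeD2r.
apply: le_trans noise_le; rewrite le_eqVlt; apply/orP; left; apply/eqP.
by apply: eq_integral => w _; rewrite /dist2 virtual_step.
Qed.

Lemma err_step t :
  (\int[P]_w (err t.+1 w)%:E <=
   (1 - delta / 2)%:E * \int[P]_w (err t w)%:E
   + (8 * L / delta)%:E * \int[P]_w (gap t w)%:E + (sigma ^+ 2)%:E)%E.
Proof.
have [d0 d1] := andP delta01.
have d1' : 0 <= 1 - delta by rewrite subr_ge0.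
have ni0 : 0 <= n%:R^-1 :> R by rewrite invr_ge0.
(* The compressor input with the oracle noise replaced by its mean; the noise adds [sigma^2] per
   client, and averaging these bounds gains no [1/n]. *)
pose U i w := e i t w + (grad (fs i) (x t w) - h i).
have mU i S : contains_past S t -> past_vec S (U i).
  move=> St; apply: vec_measurableD; first exact: e_past.
  apply: vec_measurableB; last exact: vec_measurable_cst.
  by apply: grad_vec_measurable; exact: x_past.
have mUO i : measurable_fun setT (fun w => dotv (U i w) (U i w)).
  by apply: measurable_dotv; apply: (past_vec_measurable xpredT); exact: mU.
pose V i w := e i t w + G i (x t w) (xi (t, i, false) w) - h i.
have VE i w : V i w = U i w + \sum_(k <- [:: i]) 1 *: noise k (x t w) (xi (t, k, false) w).
  rewrite big_seq1 scale1r /V /U /noise.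
  move: (e i t w) (G i _ _) (h i) (grad (fs i) _) => a b c k.
  by apply/rowP => j; rewrite !mxE; ring.
have int_V i : (\int[P]_w (dotv (V i w) (V i w))%:E
    <= \int[P]_w (dotv (U i w) (U i w))%:E + (sigma ^+ 2)%:E)%E.
  under eq_integral do rewrite VE.
  have := fresh_noise_le t [:: i] (U i) 1 isT (mU i).
  by rewrite /= expr1n !mul1r.
have int_e i : (\int[P]_w (dotv (e i t.+1 w) (e i t.+1 w))%:E
    <= (1 - delta)%:E * \int[P]_w (dotv (V i w) (V i w))%:E)%E.
  (* The compressor's input depends on the oracle draw of client [i], so that draw joins the past;
     the compressor draw itself stays fresh. *)
  pose S (j : draw_index n) := (j.1.1 < t)%N || (j == (t, i, false)).
  have St : contains_past S t by move=> j jt; rewrite /S jt.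
  have mV : past_vec S (V i).
    apply: vec_measurableB; last exact: vec_measurable_cst.
    apply: vec_measurableD; first exact: e_past.
    apply: G_measurable; first exact: x_past.
    by apply: past_draw_measurable; rewrite /S eqxx orbT.
  have mVO : measurable_fun setT (fun w => dotv (V i w) (V i w)).
    by apply: measurable_dotv; exact: past_vec_measurable mV.
  pose H (p : past xi S * Xi) :=
    dotv (C (V i p.1) p.2 - V i p.1) (C (V i p.1) p.2 - V i p.1).
  have mH : measurable_fun setT H.
    have mV1 : vec_measurable (fun p : past xi S * Xi => V i p.1).
      by move=> j; exact: (measurableT_comp (mV j) measurable_fst).
    have mCV : vec_measurable (fun p : past xi S * Xi => C (V i p.1) p.2 - V i p.1).
      by apply: vec_measurableB => //; exact: C_measurable.
    exact: measurable_dotv.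
  have step : (\int[P]_w (H (w, xi (t, i, true) w))%:E
      <= \int[P]_w ((1 - delta) * dotv (V i w) (V i w))%:E)%E.
    apply: (le_integral_fresh_draw P PXi xi xi_iid S) mH _ _ _.
    - by rewrite /S /= ltnn; apply/eqP => -[].
    - exact: measurable_funM.
    - by move=> p; exact: dotvv_ge0.
    - by move=> w; exact: (compression_moment_le (V i w)).
  have HE w : dotv (e i t.+1 w) (e i t.+1 w) = H (w, xi (t, i, true) w).
    by rewrite /H /e /= -/(V i w) -[V i w - _]opprB dotvNl dotvNr opprK.
  under eq_integral do rewrite HE.
  apply: le_trans step _; under eq_integral do rewrite EFinM.
  rewrite ge0_integralZl//; first exact/measurable_EFinP.
  by move=> w _; rewrite lee_fin dotvv_ge0.
rewrite ge0_integral_avg//; last 2 first.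
- by move=> i; apply: measurable_dotv; exact: e_measurable.
- by move=> i w; exact: dotvv_ge0.
pose B i w := (1 - delta) * dotv (U i w) (U i w) + (1 - delta) * sigma ^+ 2.
have mB i : measurable_fun setT (B i).
  by apply: measurable_funD => //; exact: measurable_funM.
have B0 i w : 0 <= B i w by rewrite addr_ge0// mulr_ge0 ?dotvv_ge0 ?sqr_ge0.
have int_e_le i : (\int[P]_w (dotv (e i t.+1 w) (e i t.+1 w))%:E
    <= \int[P]_w (B i w)%:E)%E.
  rewrite ge0_integral_lincomb//; last 2 first.
  - by move=> w; exact: dotvv_ge0.
  - by move=> w; exact: sqr_ge0.
  rewrite probability_integral_cst -ge0_muleDr ?lee_fin ?sqr_ge0//.
    by apply: le_trans (int_e i) _; apply: lee_wpmul2l.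
  by apply: integral_ge0 => w _; rewrite lee_fin dotvv_ge0.
apply: (@le_trans _ _ (n%:R^-1%:E * \sum_i \int[P]_w (B i w)%:E)%E).
  by apply: lee_wpmul2l => //; apply: lee_sum => i _; exact: int_e_le.
rewrite -ge0_integral_avg//.
rewrite -ge0_integral_lincomb//; try exact: err_measurable; try exact: err_ge0;
  try exact: gap_measurable; try exact: gap_ge0; last 2 first.
- by rewrite subr_ge0 ler_pdivrMr// mul1r (le_trans d1)// ler1n.
- by rewrite divr_ge0 ?mulr_ge0// ltW.
pose K w := (1 - delta / 2) * err t w + 8 * L / delta * gap t w.
have rho0 : 0 <= 1 - delta / 2.
  by rewrite subr_ge0 ler_pdivrMr// mul1r (le_trans d1)// ler1n.
have c0 : 0 <= 8 * L / delta by rewrite divr_ge0 ?mulr_ge0// ltW.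
have mK : measurable_fun setT K.
  apply: measurable_funD; apply: measurable_funM => //.
    exact: err_measurable.
  exact: gap_measurable.
have K0 w : 0 <= K w by rewrite addr_ge0// mulr_ge0 ?err_ge0 ?gap_ge0.
(* The constant moves under the integral, so that a pointwise comparison suffices. *)
have -> : (\int[P]_w (K w)%:E + (sigma ^+ 2)%:E =
    \int[P]_w (1 * K w + 1 * sigma ^+ 2)%:E)%E.
  rewrite [RHS]ge0_integral_lincomb//; last by move=> w; exact: sqr_ge0.
  by rewrite !mul1e probability_integral_cst.
apply: ge0_le_integral => //.
- by move=> w _; rewrite lee_fin mulr_ge0// sumr_ge0.
- by apply/measurable_EFinP; apply: measurable_funM => //; exact: measurable_sum.
- by apply/measurable_EFinP; apply: measurable_funD => //; exact: measurable_funM.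
move=> w _; rewrite lee_fin !mul1r.
pose g i := grad (fs i) (x t w) - h i.
apply: (@le_trans _ _ (n%:R^-1 * \sum_i ((1 - delta / 2) * dotv (e i t w) (e i t w)
    + 2 / delta * dotv (g i) (g i) + sigma ^+ 2))).
  rewrite ler_wpM2l// ler_sum// => i _; rewrite /B -mulrDr.
  exact: compression_error_step delta01 (sqr_ge0 sigma).
rewrite 2!big_split /= sumr_const card_ord -!mulr_sumr -[sigma ^+ 2 *+ n]mulr_natl.
have n0 : n%:R != 0 :> R by rewrite pnatr_eq0 -lt0n.
rewrite (_ : n%:R^-1 * _ = (1 - delta / 2) * err t w
    + 2 / delta * (n%:R^-1 * \sum_i dotv (g i) (g i)) + sigma ^+ 2); last first.
  by rewrite /err; field; rewrite n0 gt_eqF.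
rewrite lerD2r /K lerD2l (_ : 8 * L / delta * gap t w = 2 / delta * (4 * L * gap t w)).
  rewrite ler_wpM2l ?divr_ge0 ?(ltW d0)//.
  exact: grad_dissimilarity_le.
by field; rewrite gt_eqF.
Qed.

Lemma integral_ge0_fine_lty (g : Omega -> R) : (forall w, 0 <= g w) ->
  (\int[P]_w (g w)%:E < +oo)%E ->
  exists2 r : R, 0 <= r & (\int[P]_w (g w)%:E = r%:E)%E.
Proof.
move=> g0 goo; have i0 : (0 <= \int[P]_w (g w)%:E)%E.
  by apply: integral_ge0 => w _; rewrite lee_fin.
exists (fine (\int[P]_w (g w)%:E)%E); first exact: fine_ge0.
by rewrite fineK// ge0_fin_numE.
Qed.

(** Turns the recursions into inequalities between real sequences. Finiteness goes by induction:
    finite [dist2] and [err] at [t] make [gap] at [t] and the next [dist2] finite by [dist2_step],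
    and then the next [err] by [err_step]. *)
Lemma ec_ideal_moments : exists D E F : nat -> R,
  [/\ D 0%N = dotv (x0 - xs) (x0 - xs) /\ E 0%N = 0,
      forall t, [/\ 0 <= D t, 0 <= E t & 0 <= F t],
      forall t, (\int[P]_w (gap t w)%:E = (F t)%:E)%E,
      forall t, D t.+1 + gamma * F t <= (1 - mu * gamma / 2) * D t
        + 10 * L * gamma ^+ 3 * E t + gamma ^+ 2 * sigma ^+ 2 / n%:R &
      forall t, E t.+1 <= (1 - delta / 2) * E t + 8 * L / delta * F t + sigma ^+ 2].
Proof.
have d0w w : dist2 0 w = dotv (x0 - xs) (x0 - xs).
  by rewrite /dist2 /virtual /x /e /= big1// scaler0 subr0.
have e0w w : err 0 w = 0.
  rewrite /err /e /= big1 ?mulr0// => i _; exact: dot0v.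
have gap_fin t (a b : R) : (\int[P]_w (dist2 t w)%:E = a%:E)%E ->
    (\int[P]_w (err t w)%:E = b%:E)%E ->
    (\int[P]_w (gap t w)%:E < +oo)%E /\ (\int[P]_w (dist2 t.+1 w)%:E < +oo)%E.
  move=> da eb; have := dist2_step t; rewrite da eb -!EFinM -!EFinD.
  have : (0 <= \int[P]_w (dist2 t.+1 w)%:E)%E.
    by apply: integral_ge0 => w _; rewrite lee_fin dist2_ge0.
  have : (0 <= \int[P]_w (gap t w)%:E)%E.
    by apply: integral_ge0 => w _; rewrite lee_fin gap_ge0.
  case: (\int[P]_w (gap t w)%:E)%E => [r||] // _;
    case: (\int[P]_w (dist2 t.+1 w)%:E)%E => [q||] // _.
  - by rewrite !ltry.
  - by rewrite gt0_muley ?lte_fin.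
  - by rewrite gt0_muley ?lte_fin.
have fin t : (\int[P]_w (dist2 t w)%:E < +oo)%E /\ (\int[P]_w (err t w)%:E < +oo)%E.
  elim: t => [|t [dt et]].
    under eq_integral do rewrite d0w.
    under [in X in _ /\ X]eq_integral do rewrite e0w.
    by rewrite !probability_integral_cst !ltry.
  have [a a0 da] := integral_ge0_fine_lty _ (dist2_ge0 t) dt.
  have [b b0 eb] := integral_ge0_fine_lty _ (err_ge0 t) et.
  have [gt dt'] := gap_fin t a b da eb; split => //.
  have [c c0 gc] := integral_ge0_fine_lty _ (gap_ge0 t) gt.
  apply: le_lt_trans (err_step t) _.
  by rewrite eb gc -!EFinM -!EFinD ltry.
have finE (g : nat -> Omega -> R) : (forall t w, 0 <= g t w) ->
    (forall t, \int[P]_w (g t w)%:E < +oo)%E ->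
    forall t, (\int[P]_w (g t w)%:E = (fine (\int[P]_w (g t w)%:E))%:E)%E.
  move=> g0 goo t; have [r _ ->] := integral_ge0_fine_lty _ (g0 t) (goo t).
  by [].
have fin_gap t : (\int[P]_w (gap t w)%:E < +oo)%E.
  have [a a0 da] := integral_ge0_fine_lty _ (dist2_ge0 t) (fin t).1.
  have [b b0 eb] := integral_ge0_fine_lty _ (err_ge0 t) (fin t).2.
  exact: (gap_fin t a b da eb).1.
have Dt := finE dist2 dist2_ge0 (fun t => (fin t).1).
have Et := finE err err_ge0 (fun t => (fin t).2).
have Ft := finE gap gap_ge0 fin_gap.
exists (fun t => fine (\int[P]_w (dist2 t w)%:E)%E),
  (fun t => fine (\int[P]_w (err t w)%:E)%E),
  (fun t => fine (\int[P]_w (gap t w)%:E)%E); split => // [|t|t|t].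
- split.
    under eq_integral do rewrite d0w.
    by rewrite probability_integral_cst.
  under eq_integral do rewrite e0w.
  by rewrite probability_integral_cst.
- by split; apply: fine_ge0; apply: integral_ge0 => w _;
    rewrite lee_fin ?dist2_ge0 ?err_ge0 ?gap_ge0.
- have := dist2_step t.
  by rewrite (Dt t.+1) (Dt t) (Et t) (Ft t) -!EFinM -!EFinD lee_fin.
- have := err_step t.
  by rewrite (Et t.+1) (Et t) (Ft t) -!EFinM -!EFinD lee_fin.
Qed.

End EcIdeal.

(** * Recursion and choice of the stepsize *)

Section Recursion.
Context {R : realType}.
Implicit Types X E F : nat -> R.

(** The weight [a] makes [10 L gamma^3] equal to [a delta / 4]. Half of the contraction [delta / 2]
    of the error absorbs that term, and the other half exceeds [mu gamma / 2]. The stepsize bound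
    limits the gap fed back through [a] to [gamma / 2], half of the descent. *)
Lemma lyapunov_step (x e g x' e' mu L delta gamma N s2 : R) :
  0 < L -> 0 < delta -> 0 < gamma -> mu <= 2 * L ->
  32 * L * gamma <= delta -> 0 <= e -> 0 <= g ->
  x' + gamma * g <= (1 - mu * gamma / 2) * x + 10 * L * gamma ^+ 3 * e + N ->
  e' <= (1 - delta / 2) * e + 8 * L / delta * g + s2 ->
  let a := 40 * L * gamma ^+ 3 / delta in
  x' + a * e' + gamma / 2 * g
    <= (1 - mu * gamma / 2) * (x + a * e) + (N + a * s2).
Proof.
move=> L0 d0 g0 muL Lg e0 gap0 hx he /=; set a := _ / delta.
have a0 : 0 < a by rewrite divr_gt0 ?mulr_gt0 ?exprn_gt0.
have mug : mu * gamma / 2 <= delta / 32.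
  have : mu * gamma <= 2 * L * gamma by rewrite ler_pM2r.
  lra.
have ca : 10 * L * gamma ^+ 3 = a * (delta / 4).
  by rewrite /a; field; rewrite gt_eqF.
have q : (32 * L * gamma / delta) ^+ 2 <= 1.
  by rewrite expr_le1// ?ler_pdivrMr ?mul1r// divr_ge0 ?mulr_ge0// ltW.
have cg : a * (8 * L / delta) * g <= gamma / 2 * g.
  rewrite ler_wpM2r//.
  (* The factor is [40 * 8 / 32^2 = 5/16], below one half. *)
  rewrite (_ : a * _ = (32 * L * gamma / delta) ^+ 2 * (gamma * (5 / 16))).
    apply: (@le_trans _ _ (1 * (gamma * (5 / 16)))); first
      by rewrite ler_wpM2r// mulr_ge0// ltW.
    lra.
  by rewrite /a; field; rewrite gt_eqF.
have hae : a * e' <= a * (1 - delta / 2) * e + gamma / 2 * g + a * s2.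
  apply: (@le_trans _ _ (a * ((1 - delta / 2) * e + 8 * L / delta * g + s2))).
    by rewrite ler_pM2l.
  rewrite !mulrDr !mulrA in cg *; lra.
have ae : a * e * (mu * gamma / 2) <= a * e * (delta / 4).
  rewrite ler_wpM2l//; [by rewrite mulr_ge0// ltW|clear -mug d0; lra].
rewrite ca in hx; clear ca cg q; clearbody a; lra.
Qed.

(** Multiplying step [t] by [rho ^- t.+1] makes the [Psi] terms telescope. *)
Lemma geometric_weights_sum (Psi F : nat -> R) (rho c N : R) T : 0 < rho ->
  (forall t, Psi t.+1 + c * F t <= rho * Psi t + N) ->
  c * (\sum_(t < T) rho ^- t.+1 * F t) + rho ^- T * Psi T
    <= Psi 0%N + N * \sum_(t < T) rho ^- t.+1.
Proof.
move=> r0 step; elim: T => [|T IH].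
  by rewrite !big_ord0 expr0 invr1 !mulr0 mul1r add0r addr0.
rewrite !big_ord_recr /= !mulrDr.
have wT0 : 0 < rho ^- T.+1 by rewrite invr_gt0 exprn_gt0.
have := step T; rewrite -(ler_pM2l wT0) !mulrDr.
rewrite [rho ^- T.+1 * (rho * _)]mulrA.
have -> : rho ^- T.+1 * rho = rho ^- T.
  by rewrite exprS invfM -mulrA mulrCA mulVf ?gt_eqF// mulr1.
rewrite (mulrCA (rho ^- T.+1) c); lra.
Qed.

End Recursion.

(** * Stepsize and number of iterations *)

Section StepsizeChoice.
Context {R : realType}.
Variables (n : nat) (mu L delta sigma eps r0 S : R).
Hypotheses (n_gt0 : (0 < n)%N) (mu_gt0 : 0 < mu) (L_gt0 : 0 < L).
Hypotheses (delta01 : 0 < delta <= 1) (sigma_ge0 : 0 <= sigma) (eps_gt0 : 0 < eps).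
Hypothesis r0_ge0 : 0 <= r0.

(** The inverse of the stepsize, as a sum of three lower bounds: the first gives stability, the
    second keeps the averaged noise below [eps / 3], the third does the same for the compression
    noise, where [16^2 >= 240]. *)
Definition inv_stepsize : R := 32 * (L / delta) + 6 * (sigma ^+ 2 / (n%:R * eps))
  + 16 * (Num.sqrt L * sigma / (Num.sqrt delta * Num.sqrt eps)).
Let A := inv_stepsize.

Let delta_gt0 : 0 < delta. Proof. by case/andP: delta01. Qed.
Let nR_gt0 : 0 < n%:R :> R. Proof. by rewrite ltr0n. Qed.
Let Ld_gt0 : 0 < L / delta. Proof. exact: divr_gt0. Qed.
Let s1_ge0 : 0 <= sigma ^+ 2 / (n%:R * eps).
Proof. by rewrite divr_ge0 ?sqr_ge0// mulr_ge0// ltW. Qed.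
Let s2_ge0 : 0 <= Num.sqrt L * sigma / (Num.sqrt delta * Num.sqrt eps).
Proof. by rewrite divr_ge0 ?mulr_ge0 ?sqrtr_ge0. Qed.

Lemma inv_stepsize_gt0 : 0 < A.
Proof.
by have := Ld_gt0; have := s1_ge0; have := s2_ge0; rewrite /A /inv_stepsize; lra.
Qed.

Lemma stepsize_smoothness_le : 32 * L * A^-1 <= delta.
Proof.
rewrite ler_pdivrMr ?inv_stepsize_gt0// -ler_pdivrMl//.
rewrite [leLHS](_ : _ = 32 * (L / delta)); last by rewrite mulrC mulrA.
by have := s1_ge0; have := s2_ge0; rewrite /A /inv_stepsize; lra.
Qed.

Lemma stepsize_noise_le : 2 * A^-1 * sigma ^+ 2 / n%:R <= eps / 3.
Proof.
have A0 := inv_stepsize_gt0.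
rewrite (_ : 2 * A^-1 * sigma ^+ 2 / n%:R =
  (6 * (sigma ^+ 2 / (n%:R * eps))) * (eps / 3) * A^-1); last first.
  by field; rewrite !gt_eqF.
rewrite ler_pdivrMr// mulrC ler_pM2l ?divr_gt0//.
by have := Ld_gt0; have := s2_ge0; rewrite /A /inv_stepsize; lra.
Qed.

Lemma stepsize_compression_le : 80 * L * A^-1 ^+ 2 * sigma ^+ 2 / delta <= eps / 3.
Proof.
have A0 := inv_stepsize_gt0.
pose q := 16 * (Num.sqrt L * sigma / (Num.sqrt delta * Num.sqrt eps)).
have q0 : 0 <= q by rewrite mulr_ge0.
have qA : q <= A.
  by have := Ld_gt0; have := s1_ge0; rewrite /A /inv_stepsize /q; lra.
have q2 : q ^+ 2 = 256 * (L * sigma ^+ 2 / (delta * eps)).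
  rewrite /q !exprMn exprVn exprMn !sqr_sqrtr ?ltW//; ring.
rewrite (_ : 80 * L * A^-1 ^+ 2 * sigma ^+ 2 / delta =
  240 / 256 * q ^+ 2 * (eps / 3) * A^-1 ^+ 2); last first.
  by rewrite q2; field; rewrite !gt_eqF.
rewrite exprVn ler_pdivrMr ?exprn_gt0// [leRHS]mulrC ler_pM2r ?divr_gt0//.
apply: (@le_trans _ _ (q ^+ 2)); last by rewrite ler_pXn2r// nnegrE ltW.
by rewrite ler_piMl ?sqr_ge0//; lra.
Qed.

Hypotheses (S_ge2 : 2 <= S) (LS : L <= S) (dS : delta^-1 <= S).
Hypotheses (sS : sigma <= S) (eS : eps^-1 <= S) (rS : r0 <= S).

Let S_gt0 : 0 < S. Proof. exact: lt_le_trans S_ge2. Qed.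
Let S_ge1 : 1 <= S. Proof. by apply: le_trans S_ge2; rewrite ler1n. Qed.

Lemma sqrt_le_of_le (y : R) : y <= S -> Num.sqrt y <= S.
Proof.
move=> yS; rewrite -[leRHS]ger0_norm ?(ltW S_gt0)// -sqrtr_sqr ler_wsqrtr//.
by rewrite (le_trans yS)// expr2 ler_peMl// ltW.
Qed.

(** A crude polynomial bound on the weight needed to forget the initial distance. Only its degree
    matters, since it enters the iteration count through a logarithm. *)
Lemma inv_stepsize_poly_le : 6 * r0 * A / eps <= S ^+ 15.
Proof.
have S0 := ltW S_gt0.
have prod_le (a b p q : R) : 0 <= a -> 0 <= b -> a <= p -> b <= q -> a * b <= p * q.
  by move=> *; exact: ler_pM.
have di0 : 0 <= delta^-1 by rewrite invr_ge0 ltW.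
have ei0 : 0 <= eps^-1 by rewrite invr_ge0 ltW.
have ni0 : 0 <= n%:R^-1 :> R by rewrite invr_ge0.
have n1 : n%:R^-1 <= 1 :> R by rewrite invf_le1// ler1n.
have S1n k : 1 <= S ^+ k by rewrite exprn_ege1.
have Skl k l : (k <= l)%N -> S ^+ k <= S ^+ l by move=> kl; rewrite ler_weXn2l.
have h1 : L / delta <= S ^+ 4.
  apply: (@le_trans _ _ (S ^+ 2)); last exact: Skl.
  by rewrite expr2 prod_le// ltW.
have h2 : sigma ^+ 2 / (n%:R * eps) <= S ^+ 4.
  apply: (@le_trans _ _ (S ^+ 3)); last exact: Skl.
  rewrite invfM (_ : S ^+ 3 = S ^+ 2 * (1 * S)); last by rewrite mul1r -exprSr.
  rewrite prod_le ?sqr_ge0 ?mulr_ge0//; last exact: prod_le.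
  by rewrite ler_pXn2r ?nnegrE.
have h3 : Num.sqrt L * sigma / (Num.sqrt delta * Num.sqrt eps) <= S ^+ 4.
  rewrite invfM -!sqrtrV ?(ltW delta_gt0) ?(ltW eps_gt0)//.
  rewrite (_ : S ^+ 4 = S * S * (S * S)); last by ring.
  by rewrite !prod_le ?mulr_ge0 ?sqrtr_ge0 ?sqrt_le_of_le.
(* Each of the three summands is below [S ^+ 4], and [32 + 6 + 16 = 54]. *)
have A54 : A <= 54 * S ^+ 4 by rewrite /A /inv_stepsize; lra.
have A0 := ltW inv_stepsize_gt0.
have : r0 * A / eps <= S * (54 * S ^+ 4) * S by rewrite !prod_le ?mulr_ge0.
(* The constant [6 * 54 = 324] is below [2 ^+ 9], which [S >= 2] absorbs into nine more powers. *)
have : 2 ^+ 9 <= S ^+ 9 by rewrite ler_pXn2r ?nnegrE.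
rewrite -(ler_pM2r (exprn_gt0 6 S_gt0)) -exprD /= => h512 hA.
apply: le_trans h512.
rewrite (_ : 6 * r0 * A / eps = 6 * (r0 * A / eps)); last by ring.
apply: (@le_trans _ _ (6 * (S * (54 * S ^+ 4) * S))); first by rewrite ler_pM2l.
rewrite (_ : 6 * (S * (54 * S ^+ 4) * S) = 324 * S ^+ 6); last by ring.
by rewrite ler_pM2r ?exprn_gt0// -natrX ler_nat.
Qed.

Let gamma := A^-1.
Let rho := 1 - mu * gamma / 2.
(** Before rounding, this solves [exp (mu gamma T / 2) = S ^+ 15]. *)
Let T := Num.truncn (2 * A / mu * (15 * ln S)).

Lemma ln_S_gt0 : 0 < ln S. Proof. by rewrite ln_gt0// (lt_le_trans _ S_ge2)// ltr1n. Qed.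

Lemma iterations_le :
  T%:R <= 960 * (sigma ^+ 2 / (mu * n%:R * eps)
    + Num.sqrt L * sigma / (mu * Num.sqrt delta * Num.sqrt eps)
    + L / (mu * delta)) * ln S.
Proof.
have A0 := inv_stepsize_gt0; have l0 := ln_S_gt0.
have TA : T%:R <= 2 * A / mu * (15 * ln S).
  by rewrite /T truncn_le// !mulr_ge0// ?invr_ge0 ltW.
apply: le_trans TA _.
rewrite (_ : sigma ^+ 2 / (mu * n%:R * eps) = mu^-1 * (sigma ^+ 2 / (n%:R * eps))); last first.
  by field; rewrite !gt_eqF.
rewrite (_ : Num.sqrt L * sigma / (mu * Num.sqrt delta * Num.sqrt eps) =
  mu^-1 * (Num.sqrt L * sigma / (Num.sqrt delta * Num.sqrt eps))); last first.
  by field; rewrite !gt_eqF ?sqrtr_gt0.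
rewrite (_ : L / (mu * delta) = mu^-1 * (L / delta)); last by field; rewrite !gt_eqF.
rewrite -!mulrDr mulrA ler_pM2r//.
rewrite (_ : 2 * A / mu * 15 = mu^-1 * (30 * A)); last by ring.
rewrite [leRHS]mulrCA ler_pM2l ?invr_gt0// /A /inv_stepsize.
by have := Ld_gt0; have := s1_ge0; have := s2_ge0; lra.
Qed.

(** The last weight alone suffices: [1 - z <= exp (- z)] makes it exponentially large. Its exponent
    is [T.+1], which exceeds the number rounded down to [T]. *)
Lemma weight_total_ge : 0 < rho ->
  6 * r0 * A / eps <= \sum_(t < T.+1) rho ^- t.+1.
Proof.
move=> rho0; have A0 := inv_stepsize_gt0; have l0 := ln_S_gt0.
apply: le_trans inv_stepsize_poly_le _.
apply: (@le_trans _ _ (rho ^- T.+1)); last first.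
  rewrite big_ord_recr /= lerDr sumr_ge0// => t _.
  by rewrite invr_ge0 exprn_ge0// ltW.
have rhoe : rho <= expR (- (mu * gamma / 2)).
  by rewrite /rho; exact: expR_ge1Dx.
have : rho ^+ T.+1 <= expR (- (mu * gamma / 2)) ^+ T.+1.
  by rewrite ler_pXn2r// nnegrE ?expR_ge0 ?ltW.
rewrite -expRM_natr => rT.
have : expR (mu * gamma / 2 * T.+1%:R) <= rho ^- T.+1.
  rewrite -[leLHS]invrK -expRN lef_pV2 ?posrE ?expR_gt0 ?exprn_gt0//.
  by rewrite -mulNr.
apply: le_trans; rewrite -[S in leLHS](@lnK R) ?posrE// -expRM_natr ler_expR.
have : 2 * A / mu * (15 * ln S) < T.+1%:R by rewrite /T truncnS_gt.
move=> /ltW; rewrite -(ler_pM2l (_ : 0 < mu * gamma / 2)) ?divr_gt0 ?mulr_gt0 ?invr_gt0//.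
apply: le_trans; rewrite le_eqVlt; apply/orP; left; apply/eqP.
by rewrite /gamma; field; rewrite !gt_eqF.
Qed.

End StepsizeChoice.

Theorem theorem1 :
  exists c k : nat,
  forall (R : realType) (d n : nat) (dO dX : measure_display)
    (Omega : measurableType dO) (Xi : measurableType dX)
    (P : probability Omega R) (PXi : probability Xi R)
    (xi : draw_index n -> Omega -> Xi)
    (fs : 'I_n -> 'rV[R]_d -> R) (xs x0 : 'rV[R]_d)
    (mu L delta sigma eps : R)
    (G : 'I_n -> 'rV[R]_d -> Xi -> 'rV[R]_d) (C : 'rV[R]_d -> Xi -> 'rV[R]_d),
    (0 < n)%N -> 0 < mu -> 0 < L -> 0 < delta <= 1 -> 0 <= sigma -> 0 < eps ->
    (forall i, differentiable_everywhere (fs i)) ->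
    (forall i, convex_fun (fs i)) ->
    (forall i, smooth_fun L (fs i)) ->
    (forall x, avg_fun fs xs <= avg_fun fs x) ->
    strongly_quasi_convex mu (avg_fun fs) xs ->
    (forall i, jointly_measurable (G i)) ->
    jointly_measurable C ->
    (forall i x j, PXi.-integrable setT (fun z => (G i x z 0 j)%:E) /\
                   (\int[PXi]_z (G i x z 0 j)%:E = (grad (fs i) x 0 j)%:E)%E) ->
    (forall i x, (\int[PXi]_z ((enorm (G i x z - grad (fs i) x)) ^+ 2)%:E
                   <= (sigma ^+ 2)%:E)%E) ->
    (forall v, (\int[PXi]_z ((enorm (C v z - v)) ^+ 2)%:E
                   <= ((1 - delta) * enorm v ^+ 2)%:E)%E) ->
    iid_draws P PXi xi ->
    exists gamma : R,
      0 < gamma /\ gamma <= delta / (8 * Num.sqrt 6 * L) /\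
      exists T : nat,
        T%:R <= c%:R
                * (sigma ^+ 2 / (mu * n%:R * eps)
                   + Num.sqrt L * sigma / (mu * Num.sqrt delta * Num.sqrt eps)
                   + L / (mu * delta))
                * log_params L mu delta sigma eps (enorm (x0 - xs) ^+ 2) n ^+ k
        /\
        let hs := fun i => grad (fs i) xs in
        let wt := fun t : nat => (1 - mu * gamma / 2) ^- t.+1 in
        let W := \sum_(t < T.+1) wt t in
        (\sum_(t < T.+1)
           ((wt t / W)%:E *
            \int[P]_w ((avg_fun fs (ec_ideal G C xi hs gamma x0 t w).1
                        - avg_fun fs xs)%:E))
         <= eps%:E)%E.
Proof.
(* [960 = 2 * 15 * 32], with 32 the largest coefficient of [inv_stepsize]; a single logarithm is
   enough. *)
exists 960%N, 1%N.
move=> R d n dO dX Omega Xi P PXi xi fs xs x0 mu L delta sigma eps G C.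
move=> n0 mu0 L0 d01 s0 e0 fsd fsc fss xmin qc mG mC Gm Gv Cv iid.
have delta0 : 0 < delta by case/andP: d01.
set A := inv_stepsize n L delta sigma eps.
set r0 := enorm (x0 - xs) ^+ 2.
have r00 : 0 <= r0 by exact: sqr_ge0.
have r0E : dotv (x0 - xs) (x0 - xs) = r0 by rewrite -sqr_enorm.
set lg := log_params _ _ _ _ _ _ _.
pose S : R := 2 + L + L^-1 + mu + mu^-1 + delta^-1 + sigma + sigma^-1 + n%:R
  + eps + eps^-1 + r0 + r0^-1.
have lgE : lg = ln S by [].
(* Since the inverse of 0 is 0, [sigma^-1] and [r0^-1] stay nonnegative when [sigma] or [r0]
   vanishes, so [S] dominates every summand. *)
have nn : [/\ 0 <= L^-1, 0 <= mu^-1, 0 <= delta^-1, 0 <= sigma^-1 & 0 <= eps^-1].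
  by split; rewrite invr_ge0 // ltW.
have [Li mi di si ei] := nn.
have ri : 0 <= r0^-1 by rewrite invr_ge0.
have nR : 0 <= n%:R :> R by [].
have S2 : 2 <= S by rewrite /S; lra.
have LS : L <= S by rewrite /S; lra.
have dS : delta^-1 <= S by rewrite /S; lra.
have sS : sigma <= S by rewrite /S; lra.
have eS : eps^-1 <= S by rewrite /S; lra.
have rS : r0 <= S by rewrite /S; lra.
have A0 : 0 < A by exact: inv_stepsize_gt0.
have gamma0 : 0 < A^-1 by rewrite invr_gt0.
have smooth : 32 * L * A^-1 <= delta by exact: stepsize_smoothness_le.
clearbody S lg r0.
exists A^-1; split=> //; split.
  have s6 : 0 < Num.sqrt 6 :> R by rewrite sqrtr_gt0.
  have s64 : Num.sqrt 6 <= 4 :> R.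
    have -> : 4 = Num.sqrt (4 ^+ 2) :> R by rewrite sqrtr_sqr ger0_norm.
    by rewrite ler_wsqrtr// -natrX ler_nat.
  rewrite ler_pdivlMr ?mulr_gt0//; apply: le_trans smooth.
  rewrite mulrC ler_pM2r// ler_pM2r//; lra.
exists (Num.truncn (2 * A / mu * (15 * ln S))); split.
  rewrite lgE expr1; exact: iterations_le.
cbv zeta; set T := Num.truncn _; set rho := 1 - mu * A^-1 / 2.
set W := \sum_(t < T.+1) rho ^- t.+1.
(* In dimension 0, where [mu <= 2 * L] may fail, every iterate equals [xs] and all gaps are 0. *)
have [d0|d0] := posnP d.
  rewrite big1 ?lee_fin ?(ltW e0)// => t _.
  rewrite (_ : (fun w => _) = cst 0%E) ?integral0 ?mule0//.
  apply/funext => w /=; congr (_%:E).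
  rewrite (_ : (ec_ideal _ _ _ _ _ _ _ _).1 = xs) ?subrr//.
  by apply/rowP => -[j jd]; exfalso; move: jd; rewrite d0.
have muL : mu <= 2 * L.
  exact: (strong_quasi_convexity_le_smoothness fs L xs n0 L0 fsd fss xmin mu d0 mu0 qc).
have L16 : 16 * L * A^-1 <= 1.
  have [_ d1] := andP d01.
  have : 0 < L * A^-1 by exact: mulr_gt0.
  lra.
have [D [E [F [[D00 E00] pos FE hD hE]]]] := ec_ideal_moments P PXi xi fs xs x0 mu L
  delta sigma A^-1 G C n0 mu0 L0 d01 fsd fsc fss xmin qc mG mC Gm Gv Cv iid gamma0 muL L16.
have rho0 : 0 < rho.
  have : mu * A^-1 <= 2 * L * A^-1 by rewrite ler_pM2r.
  rewrite /rho; lra.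
have W6 : 6 * r0 * A / eps <= W by exact: weight_total_ge.
have W0 : 0 < W.
  rewrite /W big_ord_recr /= ltr_wpDl ?invr_gt0 ?exprn_gt0//.
  by apply: sumr_ge0 => t _; rewrite invr_ge0 exprn_ge0// ltW.
pose a := 40 * L * A^-1 ^+ 3 / delta.
pose N := A^-1 ^+ 2 * sigma ^+ 2 / n%:R + a * sigma ^+ 2.
have lyap t : D t.+1 + a * E t.+1 + A^-1 / 2 * F t <= rho * (D t + a * E t) + N.
  have [_ Et Ft] := pos t.
  exact: lyapunov_step (hD t) (hE t).
have := geometric_weights_sum (fun t => D t + a * E t) F rho (A^-1 / 2) N T.+1 rho0 lyap.
rewrite D00 E00 mulr0 addr0 r0E -/W => total.
have Psi0 : 0 <= rho ^- T.+1 * (D T.+1 + a * E T.+1).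
  have [Dt Et _] := pos T.+1.
  have a0 : 0 <= a by rewrite divr_ge0 ?mulr_ge0 ?exprn_ge0 ?(ltW L0) ?(ltW gamma0) ?(ltW delta0).
  apply: mulr_ge0; first by rewrite invr_ge0 exprn_ge0// ltW.
  by apply: addr_ge0 => //; exact: mulr_ge0.
rewrite (eq_bigr (fun t : 'I_T.+1 => (rho ^- t.+1 / W * F t)%:E)); last first.
  by move=> t _; rewrite [RHS]EFinM -FE.
rewrite sumEFin lee_fin.
rewrite (eq_bigr (fun t : 'I_T.+1 => W^-1 * (rho ^- t.+1 * F t))); last first.
  by move=> t _; rewrite mulrA [W^-1 * _]mulrC.
rewrite -mulr_sumr ler_pdivrMl//.
have c1 : 2 * A^-1 * sigma ^+ 2 / n%:R <= eps / 3 by exact: stepsize_noise_le.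
have c2 : 80 * L * A^-1 ^+ 2 * sigma ^+ 2 / delta <= eps / 3.
  exact: stepsize_compression_le.
(* The target splits into three parts of [eps / 3]: two for the noise in [N], one for the initial
   distance [r0]. *)
have NE : 2 * A * N <= 2 * (eps / 3).
  rewrite (_ : 2 * A * N = 2 * A^-1 * sigma ^+ 2 / n%:R
    + 80 * L * A^-1 ^+ 2 * sigma ^+ 2 / delta); first by lra.
  by rewrite /N /a; field; rewrite !gt_eqF ?ltr0n.
have r0W : 2 * A * r0 <= W * (eps / 3).
  move: W6; rewrite ler_pdivrMr//; lra.
have NW : 2 * A * N * W <= 2 * (eps / 3) * W by rewrite ler_pM2r.
set s := \sum_(t < T.+1) _.
(* The final Lyapunov value is nonnegative and is dropped; multiplying by [2 * A] then clears the
   factor [gamma / 2]. *)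
have : A^-1 / 2 * s <= r0 + N * W.
  by apply: le_trans total; rewrite lerDl; exact: Psi0.
rewrite -(ler_pM2l (_ : 0 < 2 * A)) ?mulr_gt0//.
have -> : 2 * A * (A^-1 / 2 * s) = s by field; rewrite gt_eqF.
clear -r0W NE NW; lra.
Qed.
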